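(* Let $d\in\{2,3\}$ and let $B$ be a two-parameter Brownian sheet in $\mathbf{R}^d$. Then outside a single $\mathrm{P}$-null set, \[ \dim_{\mathrm H}\Big(B^{-1}\{0\}\cap\big(\{s\}\times(0,\infty)\big)\Big)=0\qquad\text{for all }s>0 . \]
   Context: A two-parameter Brownian sheet in $\mathbf{R}^d$ is a continuous centered Gaussian process $\{B(s,t)\}_{s,t\ge0}$ with values in $\mathbf{R}^d$ and $\mathrm{Cov}(B_i(s,t),B_j(u,v))=\min(s,u)\min(t,v)\delta_{i,j}$. $B^{-1}\{0\}=\{(s,t)\in\mathbf{R}_+^2: B(s,t)=0\}$ and $\dim_{\mathrm H}$ denotes Hausdorff dimension. *)

(* Defs.v *)
From HB Require Import structures.
From mathcomp Require Import all_boot all_order all_algebra.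
From mathcomp Require Import all_classical all_reals all_analysis.
Set Implicit Arguments. Unset Strict Implicit. Unset Printing Implicit Defensive.
Import Order.TTheory GRing.Theory Num.Theory.
Import numFieldNormedType.Exports.
Local Open Scope classical_set_scope.
Local Open Scope ring_scope.

Section Defs.
Context {R : realType}.

Definition edist2 (x y : R * R) : R :=
  Num.sqrt ((x.1 - y.1) ^+ 2 + (x.2 - y.2) ^+ 2).

Definition diam2 (U : set (R * R)) : \bar R :=
  ereal_sup ([set 0%E] `|` [set (edist2 x y)%:E | x in U & y in U]).

Definition cover_term (alpha : R) (U : set (R * R)) : R :=
  if `[< U = set0 >] then 0 else powR (fine (diam2 U)) alpha.

Definition hausdorff_content (alpha delta : R) (E : set (R * R)) : \bar R :=
  ereal_inf [set (\sum_(0 <= n <oo) (cover_term alpha (U n))%:E)%E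
            | U in [set U : nat -> set (R * R) |
                     E `<=` \bigcup_n U n /\
                     forall n x y, U n x -> U n y -> edist2 x y <= delta]].

Definition hausdorff_measure (alpha : R) (E : set (R * R)) : \bar R :=
  ereal_sup [set hausdorff_content alpha delta E | delta in [set delta : R | 0 < delta]].

Definition hausdorff_dim (E : set (R * R)) : \bar R :=
  ereal_inf [set alpha%:E | alpha in [set alpha : R | 0 <= alpha /\ hausdorff_measure alpha E = 0%E]].

Definition centered_normal (dT : measure_display) (T : measurableType dT)
    (P : probability T R) (X : T -> R) (v : R) : Prop :=
  if v == 0 then P [set w | X w = 0] = 1%E
  else forall A : set R, measurable A ->
       P (X @^-1` A) = normal_prob 0 (Num.sqrt v) A.

(** B : 'I_d -> R -> R -> T -> R, B i s t w = i-th coordinate of B(s,t)(w),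
    is a two-parameter Brownian sheet in R^d on (T, P): continuous, centered
    Gaussian with Cov(B_i(s,t),B_j(u,v)) = min(s,u) min(t,v) delta_ij,
    indexed by (s,t) in R_+^2.  Gaussianity of the family is expressed as:
    every finite linear combination is centered normal with the variance
    dictated by the covariance. *)
Definition brownian_sheet (dT : measure_display) (T : measurableType dT)
    (P : probability T R) (d : nat) (B : 'I_d -> R -> R -> T -> R) : Prop :=
  (forall i s t, 0 <= s -> 0 <= t -> measurable_fun setT (B i s t)) /\
  (forall i w, {within [set p : R * R | 0 <= p.1 /\ 0 <= p.2],
                 continuous (fun p : R * R => B i p.1 p.2 w)}) /\
  (forall (n : nat) (idx : 'I_n -> 'I_d) (s t a : 'I_n -> R),
     (forall k, 0 <= s k /\ 0 <= t k) ->
     centered_normal P (fun w => \sum_(k < n) a k * B (idx k) (s k) (t k) w)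
       (\sum_(k < n) \sum_(l < n)
          a k * a l * (Num.min (s k) (s l) * Num.min (t k) (t l))
          * (idx k == idx l)%:R)).

End Defs.

(* Main.v *)
Require Import Defs.
From HB Require Import structures.
From mathcomp Require Import all_boot all_order all_algebra.
From mathcomp Require Import all_classical all_reals all_analysis.
From mathcomp Require Import measurable_realfun.
From mathcomp Require Import ring lra zify.
Import Order.TTheory GRing.Theory Num.Theory.
Import numFieldNormedType.Exports.
Local Open Scope classical_set_scope.
Local Open Scope ring_scope.

(** Only two coordinates [B_1, B_2] of the sheet are needed.  Cut time into cells of
    side [b ^- m].  By chaining over the grids, almost surely a zero of
    [(B_1, B_2)] in a cell of level [m] (large) forces both coordinates to be at
    most [r ~ b ^- (m (1/2 - eps))] at the corner of that cell.  Along one strip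
    [{S} x R], the expected number of increasing [n]-tuples of grid points with
    this property is at most [(C r^2 b^m log(b^m))^n]: replacing the indicator of
    [|x| <= r] by [exp (- x^2 / (2 r^2))], an average of cosines, only the
    characteristic functions of linear combinations of the process are needed,
    and the independent increments make the bound factor over the gaps of the
    tuple.  Since [n] is arbitrary, Markov's inequality and a union bound over the
    [O(b^m)] strips show that almost surely, for all large [m], every strip of
    level [m] has at most [b ^ (eps' m)] such points; so every slice is covered by
    that many sets of diameter [b ^- m], and its Hausdorff dimension is [0]. *)

Set Implicit Arguments.
Unset Strict Implicit.

(** The slices are uncountably many and one null set must serve all of them, so an estimate for a
    fixed [s] is not enough: the failure probability of one strip has to beat the number of strips,
    a power of [b ^ m]. This forces high moments. One integer [q] sets all parameters. Times stay
    below [q], strips are kept only for [S >= 1 / q] because the estimate degenerates as [S] tends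
    to 0, and [b = 4 ^ q]. With [F = 2 ^ m] every quantity is, up to constants, a power of [F]:
    [b ^ m = F ^ (2 q)], [r ^ 2 * b ^ m] has order [F ^ 2], the logarithm is at most of order [F],
    and the tolerated number of hits has order [16 ^ m = F ^ 4]. Markov's inequality leaves
    [(F ^ 3 / F ^ 4) ^ n], which beats [F ^ (2 q)] strips once [n = 2 q + 1]. As [q] grows, [16 ^ m]
    becomes a negligible power of [b ^ m]. *)

Lemma measurable_superlevel (R : realType) (d : measure_display) (T : measurableType d)
    (X : T -> R) (l : R) :
  measurable_fun setT X -> measurable [set w | l <= X w].
Proof.
move=> mX; rewrite (_ : [set w | _] = setT `&` X @^-1` `[l, +oo[%classic).
  by apply: mX => //; exact: measurable_itv.
by rewrite setTI; apply/seteqP; split => w /=; rewrite in_itv/= andbT.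
Qed.

Lemma measurable_norm_superlevel (R : realType) (d : measure_display)
    (T : measurableType d) (X : T -> R) (l : R) :
  measurable_fun setT X -> measurable [set w | l <= `|X w|].
Proof. by move=> mX; apply: measurable_superlevel; apply: measurableT_comp. Qed.

(** * Centered normal laws on the line: tails, characteristic function, smoothing *)

Section Normal.
Context {R : realType}.
Notation mu := (@lebesgue_measure R).
Implicit Types s u x : R.

Lemma normal_pdf0E s u : s != 0 ->
  normal_pdf 0 s u = normal_peak s * expR (- (u ^+ 2 / (s ^+ 2 *+ 2))).
Proof. by move=> s0; rewrite normal_pdfE// /normal_fun subr0 mulNr. Qed.

Lemma normal_peak2 s : 0 < s -> normal_peak s = 2 * normal_peak (2 * s).
Proof.
move=> s0; rewrite /normal_peak.
rewrite (_ : (2 * s) ^+ 2 * pi *+ 2 = 2 ^+ 2 * (s ^+ 2 * pi *+ 2)); last by ring.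
rewrite sqrtrM ?exprn_ge0// sqrtr_sqr ger0_norm// invfM mulrA divff ?mul1r//.
Qed.

(** Doubling the standard deviation leaves room in the exponent: [1/4 + 1/8 <= 1/2]. The spare
    factor gives the tail bound and absorbs a factor [|u|]. *)
Lemma normal_pdf_le s u : 0 < s ->
  normal_pdf 0 s u <= 2 * expR (- (u ^+ 2 / (4 * s ^+ 2))) * normal_pdf 0 (2 * s) u.
Proof.
move=> s0; have s20 : 2 * s != 0 by rewrite mulf_neq0// gt_eqF.
rewrite !normal_pdf0E ?gt_eqF// ?mulr_gt0// normal_peak2// -!mulrA ler_pM2l//.
rewrite (mulrCA (expR _)) (ler_wpM2l (normal_peak_ge0 _))// -expRD ler_expR.
rewrite -opprD lerN2 -subr_ge0.
rewrite (_ : _ - _ = 8%:R^-1 * u ^+ 2 * (s ^+ 2)^-1); last by field; rewrite gt_eqF.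
by apply: mulr_ge0; rewrite ?invr_ge0 ?sqr_ge0//; apply: mulr_ge0; rewrite ?sqr_ge0// invr_ge0.
Qed.

(** The spare exponential beats [|u|] by [expR x >= 1 + x] and a completed square. The result is an
    integrable majorant for differentiation under the integral. *)
Lemma norm_normal_pdf_le s u : 0 < s ->
  `|u| * normal_pdf 0 s u <= 4 * s * normal_pdf 0 (2 * s) u.
Proof.
move=> s0; apply: le_trans (ler_wpM2l (normr_ge0 _) (normal_pdf_le u s0)) _.
rewrite mulrA ler_wpM2r ?normal_pdf_ge0//.
rewrite mulrCA [leRHS](_ : _ = 2 * (2 * s)); last by ring.
rewrite ler_pM2l// expRN ler_pdivrMr ?expR_gt0//.
apply: le_trans (ler_wpM2l _ (expR_ge1Dx _)); last by rewrite mulr_ge0// ltW.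
rewrite -(@ler_pM2l _ (2 * s)) ?mulr_gt0// -subr_ge0.
rewrite (_ : _ - _ = (2 * s - `|u|) ^+ 2 + 2 * s * `|u|); last first.
  by rewrite -(real_normK (num_real u)); field; rewrite gt_eqF.
by rewrite addr_ge0 ?sqr_ge0// mulr_ge0// mulr_ge0// ltW.
Qed.

Lemma normal_prob_tail s (l : R) : 0 < s -> 0 <= l ->
  (normal_prob 0 s [set u : R | (l <= `|u|)%R] <= (2 * expR (- (l ^+ 2 / (4 * s ^+ 2))))%R%:E)%E.
Proof.
move=> s0 l0; have mA : measurable [set u : R | (l <= `|u|)%R].
  by apply: measurable_norm_superlevel.
rewrite /normal_prob.
apply: (@le_trans _ _ (\int[mu]_(x in [set u : R | (l <= `|u|)%R])
   ((2 * expR (- (l ^+ 2 / (4 * s ^+ 2))))%R%:E * (normal_pdf 0 (2 * s) x)%:E))%E).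
  apply: ge0_le_integral => //=.
  - by move=> x _; rewrite lee_fin normal_pdf_ge0.
  - by apply/measurable_EFinP/measurable_funTS; exact: measurable_normal_pdf.
  - by apply: emeasurable_funM; apply/measurable_EFinP => //;
      apply: measurable_funTS; exact: measurable_normal_pdf.
  - move=> x lx; rewrite -EFinM lee_fin.
    apply: le_trans (normal_pdf_le x s0) _.
    rewrite ler_wpM2r ?normal_pdf_ge0// ler_pM2l// ler_expR lerN2.
    rewrite ler_wpM2r ?invr_ge0 ?mulr_ge0 ?(ltW s0)//.
    by rewrite -(real_normK (num_real x)) ler_sqr ?nnegrE.
rewrite ge0_integralZl//=.
- rewrite -[leRHS]mule1 lee_wpmul2l ?lee_fin ?mulr_ge0 ?expR_ge0//.
  rewrite -(integral_normal_pdf 0 (2 * s)).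
  apply: ge0_subset_integral => //=.
    by apply/measurable_EFinP; exact: measurable_normal_pdf.
  by move=> x _; rewrite lee_fin normal_pdf_ge0.
- by apply/measurable_EFinP/measurable_funTS; exact: measurable_normal_pdf.
- by move=> x _; rewrite lee_fin normal_pdf_ge0.
Qed.

(** The Radon-Nikodym derivative of [normal_prob] is determined only up to null sets; equality of
    the integrals over all measurable sets identifies it almost everywhere with [normal_pdf]. *)
Lemma integral_normal_prob m s (f : R -> R) :
  (normal_prob m s).-integrable setT (EFin \o f) ->
  (\int[normal_prob m s]_x (f x)%:E = \int[mu]_x (f x * normal_pdf m s x)%:E)%E.
Proof.
move=> fi; have dom := normal_prob_dominates m s.
rewrite -(Radon_Nikodym_change_of_variables dom)//=.
have mf : measurable_fun setT (EFin \o f) by case/integrableP : fi.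
under [RHS]eq_integral do rewrite EFinM.
apply: ae_eq_integral => //.
- apply: emeasurable_funM => //; apply: (measurable_int mu).
- apply: emeasurable_funM => //=; apply/measurable_EFinP.
  exact: measurable_normal_pdf.
- apply: ae_eqe_mul2l => /=.
  rewrite Radon_NikodymE//=.
  case: cid => /= h [h1 h2 h3].
  apply: integral_ae_eq => //=.
    by apply/measurable_EFinP; exact: measurable_normal_pdf.
  by move=> E E01 mE; rewrite -h3.
Qed.


(** Fundamental theorem of calculus on growing symmetric intervals, then dominated convergence with
    [|g'|] itself as majorant. *)
Lemma Rintegral_derive_eq0 (g g' : R -> R) :
  (forall u, is_derive u 1 g (g' u)) -> continuous g' ->
  mu.-integrable setT (EFin \o g') ->
  (fun n : nat => g n.+1%:R - g (- n.+1%:R)) @ \oo --> (0 : R) ->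
  \int[mu]_u g' u = 0.
Proof.
move=> dg cg' ig' g0.
pose D (n : nat) : set R := `[- n.+1%:R, n.+1%:R]%classic.
have mD n : measurable (D n) by exact: measurable_itv.
have FTC (n : nat) : (\int[mu]_(u in D n) (g' u)%:E =
    (g n.+1%:R - g (- n.+1%:R))%:E)%E.
  rewrite /D (@continuous_FTC2 _ g' g) ?EFinB//.
  - by rewrite ltrNl (lt_trans (_ : _ < 0)) ?oppr_lt0 ?ltr0n.
  - exact: continuous_subspaceT.
  - have cg : continuous g.
      by move=> u; apply/differentiable_continuous/derivable1_diffP.
    split.
    + by move=> u _; case: (dg u).
    + exact/cvg_at_right_filter/cg.
    + exact/cvg_at_left_filter/cg.
  - by move=> u _; rewrite derive1E; apply: derive_val.
have mg' : measurable_fun setT (EFin \o g') by case/integrableP : ig'.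
have mr n : measurable_fun setT ((EFin \o g') \_ (D n)).
  by apply/(measurable_restrictT _ (mD n)); apply: measurable_funTS.
have cvg1 : (\int[mu]_u ((EFin \o g') \_ (D n)) u @[n --> \oo] -->
    \int[mu]_u (EFin \o g') u)%E.
  apply: (@dominated_cvg _ _ _ mu setT measurableT
      (fun n => (EFin \o g') \_ (D n)) _ (abse \o (EFin \o g'))).
  - exact: mr.
  - move=> u _; apply: cvg_near_cst.
    near=> n; rewrite patchE mem_set//= /D/= in_itv/= -ler_norml.
    near: n; exists (Num.truncn `|u|) => // n /= le_n.
    apply: (le_trans (ltW (truncnS_gt _))).
    by rewrite ler_nat ltnS.
  - by [].
  - exact: integrable_abse.
  - move=> n u _ /=; rewrite patchE; case: ifPn => // _.
    by rewrite abse0.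
have cvg2 : ((g n.+1%:R - g (- n.+1%:R))%:E @[n --> \oo] --> 0%E)%E.
  exact/cvg_EFin/g0/nearW.
rewrite /Rintegral.
have := cvg1.
under eq_fun do rewrite -integral_mkcond FTC.
by move/cvg_lim => <-//; rewrite (cvg_lim _ cvg2).
Unshelve. all: by end_near. Qed.

Lemma is_derive_normal_pdf s u : 0 < s ->
  is_derive u 1 (normal_pdf 0 s) (- (u / s ^+ 2) * normal_pdf 0 s u).
Proof.
move=> s0.
rewrite (_ : normal_pdf 0 s = fun u => normal_peak s * expR (- (s ^+ 2 *+ 2)^-1 * u ^+ 2)); last first.
  by apply/funext => v; rewrite normal_pdf0E ?gt_eqF// mulrC mulNr [in X in - X]mulrC mulrC.
apply: is_derive_eq.
rewrite /GRing.scale/=.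
by field; rewrite gt_eqF.
Qed.

Lemma integrable_le_normal_pdf s (C : R) (f : R -> R) :
  measurable_fun setT f -> (forall u, `|f u| <= C * normal_pdf 0 s u) ->
  mu.-integrable setT (EFin \o f).
Proof.
move=> mf fC; apply: (@le_integrable _ _ _ mu setT measurableT _
  (EFin \o (fun u => C * normal_pdf 0 s u))).
- exact/measurable_EFinP.
- move=> u _ /=; rewrite lee_fin.
  exact: le_trans (fC u) (ler_norm _).
- exact: (@integrableZl _ _ _ mu setT measurableT C _ (integrable_normal_pdf 0 s)).
Qed.

Lemma measurable_sinM x : measurable_fun setT (fun u : R => sin (x * u)).
Proof.
apply: continuous_measurable_fun => u.
apply: continuous_comp; [exact: mulrl_continuous|exact: continuous_sin].
Qed.

Lemma measurable_cosM x : measurable_fun setT (fun u : R => cos (x * u)).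
Proof.
apply: continuous_measurable_fun => u.
apply: continuous_comp; [exact: mulrl_continuous|exact: continuous_cos].
Qed.

Lemma norm_sin_le1 x : `|sin x| <= 1.
Proof. by rewrite ler_norml sin_geN1 sin_le1. Qed.

Lemma norm_cos_le1 x : `|cos x| <= 1.
Proof. by rewrite ler_norml cos_geN1 cos_le1. Qed.

Lemma integrable_cos_normal_pdf s x :
  mu.-integrable setT (EFin \o (fun u => cos (x * u) * normal_pdf 0 s u)).
Proof.
apply: (@integrable_le_normal_pdf s 1).
- apply: measurable_funM; [exact: measurable_cosM|exact: measurable_normal_pdf].
- move=> u; rewrite normrM (ger0_norm (normal_pdf_ge0 _ _ _)).
  by rewrite ler_wpM2r ?normal_pdf_ge0// norm_cos_le1.
Qed.

Lemma integrable_sin_normal_pdf s x : 0 < s ->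
  mu.-integrable setT (EFin \o (fun u => sin (x * u) * (u * normal_pdf 0 s u))).
Proof.
move=> s0; apply: (@integrable_le_normal_pdf (2 * s) (4 * s)).
- apply: measurable_funM; first exact: measurable_sinM.
  by apply: measurable_funM => //; exact: measurable_normal_pdf.
- move=> u; rewrite !normrM (ger0_norm (normal_pdf_ge0 _ _ _)).
  rewrite -[leRHS]mul1r ler_pM ?norm_sin_le1 ?norm_normal_pdf_le//.
  by rewrite mulr_ge0 ?normal_pdf_ge0.
Qed.

(** Gaussian integration by parts: the derivative of [sin (x u)] times the density has integral
    0. *)
Lemma Rintegral_sin_normal_pdf s x : 0 < s ->
  \int[mu]_u (sin (x * u) * (u * normal_pdf 0 s u)) =
  s ^+ 2 * x * \int[mu]_u (cos (x * u) * normal_pdf 0 s u).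
Proof.
move=> s0.
pose g u := sin (x * u) * normal_pdf 0 s u.
pose g' u := x * (cos (x * u) * normal_pdf 0 s u) +
  - (s ^+ 2)^-1 * (sin (x * u) * (u * normal_pdf 0 s u)).
have i1 : mu.-integrable setT (EFin \o (fun u => x * (cos (x * u) * normal_pdf 0 s u))).
  exact: (@integrableZl _ _ _ mu setT measurableT x _ (integrable_cos_normal_pdf s x)).
have i2 : mu.-integrable setT (EFin \o (fun u =>
    - (s ^+ 2)^-1 * (sin (x * u) * (u * normal_pdf 0 s u)))).
  exact: (@integrableZl _ _ _ mu setT measurableT _ _ (integrable_sin_normal_pdf x s0)).
have : \int[mu]_u g' u = 0.
  apply: (@Rintegral_derive_eq0 g).
  - move=> u; have dp := is_derive_normal_pdf u s0.
    have ds : is_derive u 1 (fun u : R => sin (x * u)) (cos (x * u) * x).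
      by apply: is_derive_eq; rewrite /GRing.scale/= mulr1.
    apply: is_derive_eq; rewrite /GRing.scale/= /g'.
    by field; rewrite gt_eqF.
  - have cp : continuous (normal_pdf 0 s) by apply: continuous_normal_pdf; rewrite gt_eqF.
    move=> u; apply: cvgD; (apply: cvgM; first exact: cvg_cst); apply: cvgM.
    + apply: continuous_comp; [exact: mulrl_continuous|exact: continuous_cos].
    + exact: cp.
    + apply: continuous_comp; [exact: mulrl_continuous|exact: continuous_sin].
    + by apply: cvgM; [exact: cvg_id|exact: cp].
  - exact: (@integrableD _ _ _ mu setT measurableT _ _ i1 i2).
  (* Since [|u|] times the density is bounded, each boundary term is of order [1 / n]; the leading 2
     is for the two ends. *)
  - pose C := 2 * (4 * s * normal_peak (2 * s)).
    have gC (n : nat) : `|g n.+1%:R - g (- n.+1%:R)| <= C * n.+1%:R^-1.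
      rewrite ler_pdivlMr ?ltr0n// /C.
      have pn u : `|u| = n.+1%:R -> `|g u| * n.+1%:R <= 4 * s * normal_peak (2 * s).
        move=> un; rewrite -un normrM -(mulrA `|sin _|) -[leRHS]mul1r ler_pM ?norm_sin_le1//.
        rewrite mulrC (ger0_norm (normal_pdf_ge0 _ _ _)).
        apply: (le_trans (norm_normal_pdf_le u s0)).
        by rewrite ler_pM2l ?mulr_gt0// normal_pdf_ub// gt_eqF// mulr_gt0.
      apply: (@le_trans _ _ ((`|g n.+1%:R| + `|g (- n.+1%:R)|) * n.+1%:R)).
        by rewrite ler_wpM2r// ler_normB.
      by rewrite mulrDl [leRHS]mulr_natl mulr2n lerD// pn ?normrN ?normr_nat.
    apply: norm_cvg0.
    apply: (@squeeze_cvgr _ _ _ _ (cst 0) (fun n => C * n.+1%:R^-1)).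
    + by apply: nearW => n; rewrite normr_ge0 gC.
    + exact: cvg_cst.
    + rewrite -[X in _ --> X](mulr0 C); apply: cvgM; first exact: cvg_cst.
      exact: cvg_harmonic.
rewrite /g' RintegralD//.
rewrite RintegralZl//; last exact: integrable_cos_normal_pdf.
rewrite RintegralZl//; last exact: integrable_sin_normal_pdf.
move=> /eqP; rewrite mulNr subr_eq0 => /eqP h.
by rewrite -mulrA h mulrA divff ?mul1r// expf_neq0// gt_eqF.
Qed.

(** Differentiation under the integral and the integration by parts above give
    [F' y = - s ^ 2 * y * F y], so [F y * exp (s ^ 2 * y ^ 2 / 2)] is constant, equal to its value 1
    at 0. *)
Lemma normal_charfun s x : 0 < s ->
  \int[mu]_u (cos (x * u) * normal_pdf 0 s u) = expR (- (x ^+ 2 * s ^+ 2 / 2)).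
Proof.
move=> s0.
pose f x u := cos (x * u) * normal_pdf 0 s u.
pose F x := \int[mu]_u f x u.
have df (y u : R) : is_derive y 1 (f ^~ u) (- (sin (y * u) * (u * normal_pdf 0 s u))).
  by apply: is_derive_eq; rewrite /GRing.scale/=; ring.
have d1f (y u : R) : partial1of2 f y u = - (sin (y * u) * (u * normal_pdf 0 s u)).
  by rewrite partial1of2E; apply: derive_val.
pose G u := 4 * s * normal_pdf 0 (2 * s) u.
have Gf y u : `|partial1of2 f y u| <= G u.
  rewrite d1f normrN !normrM (ger0_norm (normal_pdf_ge0 _ _ _)).
  rewrite -[leRHS]mul1r ler_pM ?norm_sin_le1 ?norm_normal_pdf_le//.
  by rewrite mulr_ge0 ?normal_pdf_ge0.
have G0 u : 0 <= G u by rewrite mulr_ge0 ?normal_pdf_ge0 ?mulr_ge0 ?(ltW s0).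
have iG : mu.-integrable setT (EFin \o G).
  exact: (@integrableZl _ _ _ mu setT measurableT _ _ (integrable_normal_pdf 0 (2 * s))).
have yI (y : R) : `]y - 1, y + 1[%classic y by rewrite /= in_itv/= gtrBl ltrDl ltr01.
have dF (y : R) : is_derive y 1 F (- (s ^+ 2 * y) * F y).
  apply: DeriveDef.
    apply: (@derivable_under_integral R _ _ mu f setT measurableT y _ _ (yI y)
      _ _ G G0 iG) => //.
    by move=> z _; exact: integrable_cos_normal_pdf.
  rewrite -derive1E.
  rewrite (@differentiation_under_integral R _ _ mu f setT measurableT y _ _ (yI y)
      _ _ G G0 iG) => //; last by move=> z _; exact: integrable_cos_normal_pdf.
  under eq_Rintegral do rewrite d1f -mulN1r.
  rewrite RintegralZl//; last exact: integrable_sin_normal_pdf.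
  by rewrite Rintegral_sin_normal_pdf// mulN1r mulNr.
pose H y := F y * expR (s ^+ 2 / 2 * y ^+ 2).
have H0 : H x = H 0.
  apply: is_derive_0_is_cst => y.
  have dFy := dF y.
  by apply: is_derive_eq; rewrite /GRing.scale/=; field.
have F0 : F 0 = 1.
  rewrite /F /f; under eq_Rintegral do rewrite mul0r cos0 mul1r.
  by rewrite /Rintegral integral_normal_pdf.
move: H0; rewrite /H F0 mul1r expr0n/= mulr0 expR0.
move=> /(congr1 (fun z => z * expR (- (s ^+ 2 / 2 * x ^+ 2)))).
rewrite -(mulrA (F x)) -expRD subrr expR0 mulr1 mul1r => Fx.
rewrite -[LHS]/(F x) Fx; congr (expR (- _)); by field.
Qed.

(** The integrand is, up to its peak, the normal density of mean [- a] and variance [1 / v].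
    Bounding the density of the measure by its own peak leaves the ratio of the two peaks, whatever
    the shift [a]. *)
Lemma normal_smoothing s (v a : R) : 0 < s -> 0 < v ->
  (\int[normal_prob 0 s]_u (expR (- (v * (a + u) ^+ 2 / 2)))%:E <=
    (1 / (s * Num.sqrt v))%:E)%E.
Proof.
move=> s0 v0; pose t := (Num.sqrt v)^-1.
have t0 : 0 < t by rewrite invr_gt0 sqrtr_gt0.
have tv : t ^+ 2 = v^-1 by rewrite exprVn sqr_sqrtr// ltW.
have mf : measurable_fun setT (fun u : R => expR (- (v * (a + u) ^+ 2 / 2))).
  apply: measurableT_comp => //; apply: measurableT_comp => //.
  apply: measurable_funM => //; apply: measurable_funM => //.
  by apply: measurable_funX; apply: measurable_funD.
rewrite integral_normal_prob; last first.
  apply: measurable_bounded_integrable => //.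
    by rewrite /= /normal_prob integral_normal_pdf ltry.
  exists 1; split => // z z1 u _ /=.
  rewrite ger0_norm ?expR_ge0// (le_trans _ (ltW z1))//.
  rewrite -[leRHS]expR0 ler_expR oppr_le0.
  by rewrite divr_ge0// mulr_ge0 ?sqr_ge0// ltW.
apply: (@le_trans _ _ (\int[mu]_u ((normal_peak s / normal_peak t)%:E *
    (normal_pdf (- a) t u)%:E))%E).
  apply: ge0_le_integral => //=.
  - by move=> u _; rewrite lee_fin mulr_ge0 ?expR_ge0 ?normal_pdf_ge0.
  - apply/measurable_EFinP; apply: measurable_funM => //.
    exact: measurable_normal_pdf.
  - apply/measurable_EFinP; apply: measurable_funM => //.
    exact: measurable_normal_pdf.
  - move=> u _; rewrite -EFinM lee_fin.
    have -> : normal_pdf (- a) t u = normal_peak t * normal_fun (- a) t u.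
      by rewrite normal_pdfE ?gt_eqF.
    rewrite -(mulrA (normal_peak s)) mulKf ?gt_eqF ?normal_peak_gt0 ?gt_eqF//.
    rewrite mulrC ler_pM ?normal_pdf_ge0 ?expR_ge0 ?normal_pdf_ub ?gt_eqF//.
    rewrite /normal_fun tv opprK ler_expR le_eqVlt; apply/orP; left; apply/eqP.
    by field; rewrite gt_eqF.
rewrite ge0_integralZl//=; last 3 first.
- apply/measurable_EFinP; exact: measurable_normal_pdf.
- by move=> u _; rewrite lee_fin normal_pdf_ge0.
- by rewrite lee_fin divr_ge0 ?normal_peak_ge0.
rewrite integral_normal_pdf mule1 lee_fin le_eqVlt; apply/orP; left; apply/eqP.
rewrite /normal_peak -!mulrnAr.
have sqrtE (z : R) : 0 < z -> Num.sqrt (z ^+ 2 * (pi *+ 2)) = z * Num.sqrt (pi *+ 2).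
  by move=> z0; rewrite sqrtrM ?sqr_ge0// sqrtr_sqr gtr0_norm.
rewrite !sqrtE// /t.
have pi0 : Num.sqrt ((pi : R) *+ 2) != 0 by rewrite gt_eqF// sqrtr_gt0 mulrn_wgt0// pi_gt0.
by field; rewrite pi0 !gt_eqF// sqrtr_gt0.
Qed.

End Normal.

(** * Centered normal variables through cosines *)

Section Gaussian.
Context {R : realType} (dT : measure_display) (T : measurableType dT).
Variable P : probability T R.
Implicit Types X L Z F : T -> R.

Lemma bounded_integrable_prob X (C : R) :
  measurable_fun setT X -> (forall w, `|X w| <= C) -> P.-integrable setT (EFin \o X).
Proof.
move=> mX XC; apply: measurable_bounded_integrable => //.
  by apply: (le_lt_trans (probability_le1 P measurableT)); rewrite ltry.
exists C; split; first by rewrite num_real.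
by move=> z Cz w _ /=; exact: (le_trans (XC w) (ltW Cz)).
Qed.

(** For [v = 0] the variable vanishes almost surely and the cosine is 1; otherwise the law is
    transported to the line. *)
Lemma centered_normal_charfun X (v : R) : measurable_fun setT X -> 0 <= v ->
  centered_normal P X v -> \int[P]_w cos (X w) = expR (- (v / 2)).
Proof.
move=> mX v0; rewrite /centered_normal.
pose X' : {RV P >-> measurableTypeR R} :=
  HB.pack X (isMeasurableFun.Build _ _ T (measurableTypeR R) X mX).
have mcos : measurable_fun setT (EFin \o @cos R).
  by apply/measurable_EFinP; apply: continuous_measurable_fun; exact: continuous_cos.
have mcX : measurable_fun setT (fun w => cos (X w)).
  apply: measurableT_comp => //.
  by apply: continuous_measurable_fun; exact: continuous_cos.
have icX : P.-integrable setT (EFin \o (fun w => cos (X w))).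
  by apply: (bounded_integrable_prob mcX) => w; exact: norm_cos_le1.
have [-> X0|vn0 XN] := eqVneq v 0.
  rewrite mul0r oppr0 expR0 /Rintegral.
  have mX0 : measurable [set w | X w = 0].
    rewrite (_ : [set w | _] = setT `&` X @^-1` [set 0]); last by rewrite setTI.
    by apply: (mX measurableT) => //; exact: measurable_set1.
  rewrite (_ : 1 = fine 1%E)//; congr fine.
  transitivity (\int[P]_w (cst 1%E w))%E; last first.
    by rewrite integral_cst// mul1e; exact: probability_setT.
  apply: ae_eq_integral => //.
  - by case/integrableP : icX.
  - exists (~` [set w | X w = 0]); split.
    + exact: measurableC.
    + by apply: (etrans (probability_setC P mX0)); rewrite X0 subee.
    + by move=> w /= h Xw0; apply: h => _; rewrite Xw0 cos0.
pose s := Num.sqrt v.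
have s0 : 0 < s by rewrite sqrtr_gt0 lt0r vn0.
rewrite -[v in RHS](sqr_sqrtr v0) -/s.
have /= := normal_charfun 1 s0; rewrite expr1n mul1r => <-.
rewrite /Rintegral; congr fine.
rewrite -(integral_distribution (X := X') mcos icX).
transitivity (\int[normal_prob 0 s]_y (EFin \o @cos R) y)%E.
  by apply: eq_measure_integral => A mA _; exact: XN.
rewrite (integral_normal_prob (f := @cos R)).
  by apply: eq_integral => u _; rewrite mul1r.
apply: measurable_bounded_integrable => //.
- by rewrite /= /normal_prob integral_normal_pdf ltry.
- by apply/measurable_EFinP.
- exists 1; split => // z z1 u _ /=.
  exact: le_trans (norm_cos_le1 u) (ltW z1).
Qed.

Lemma Rintegral_cos_normal_prob (s x : R) : 0 < s ->
  (\int[normal_prob 0 s]_u (cos (x * u))%:E = (expR (- (x ^+ 2 * s ^+ 2 / 2)))%:E)%E.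
Proof.
move=> s0; rewrite (integral_normal_prob (f := fun u => cos (x * u))); last first.
  apply: measurable_bounded_integrable => //.
  - by rewrite /= /normal_prob integral_normal_pdf ltry.
  - exact: measurable_cosM.
  - exists 1; split => // z z1 u _ /=.
    exact: le_trans (norm_cos_le1 _) (ltW z1).
rewrite -(normal_charfun x s0) fineK//.
apply: integrable_fin_num => //; exact: integrable_cos_normal_pdf.
Qed.

(* [exp(- Z^2 s^2 / 2)] is the average of [cos (u Z)] over a centered normal [u]
   of standard deviation [s], and
   [cos l * cos (u z) = (cos (l + u z) + cos (l - u z)) / 2]. *)
Lemma cos_gaussian_kernel_le L Z F (s v a C : R) : 0 < s -> 0 < v -> 0 <= C ->
  measurable_fun setT L -> measurable_fun setT Z -> measurable_fun setT F ->
  (forall w, `|F w| <= 1) ->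
  (forall u, \int[P]_w (cos (L w + u * Z w) * F w) <=
             C * expR (- (v * (a + u) ^+ 2 / 2))) ->
  \int[P]_w (cos (L w) * (expR (- (Z w ^+ 2 * s ^+ 2 / 2)) * F w)) <=
    C * (1 / (s * Num.sqrt v)).
Proof.
move=> s0 v0 C0 mL mZ mF F1 H.
have mcos : measurable_fun setT (@cos R).
  by apply: continuous_measurable_fun; exact: continuous_cos.
pose N : probability _ R := normal_prob 0 s.
pose h (z : measurableTypeR R * T) := cos (L z.2) * cos (Z z.2 * z.1) * F z.2.
have mh : measurable_fun setT h.
  apply: measurable_funM; last exact: measurableT_comp.
  apply: measurable_funM; apply: measurableT_comp => //.
    exact: measurableT_comp.
  by apply: measurable_funM => //; exact: measurableT_comp.
have h1 z : `|h z| <= 1.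
  rewrite /h !normrM -[leRHS]mul1r ler_pM// ?mulr_ge0//.
  by rewrite -[leRHS]mul1r ler_pM// norm_cos_le1.
have ih : (N \x P)%E.-integrable setT (EFin \o h).
  apply: measurable_bounded_integrable => //.
    apply: (@le_lt_trans _ _ (N setT * P setT)%E).
      by rewrite -[X in (_ X <= _)%E]setXTT le_eqVlt; apply/orP; left; apply/eqP; exact: product_measure1E.
    apply: (le_lt_trans (lee_pmul _ _ (probability_le1 N measurableT)
      (probability_le1 P measurableT))) => //.
    by rewrite mul1e ltry.
  exists 1; split => // z z1 u _ /=.
  exact: le_trans (h1 u) (ltW z1).
have -> : \int[P]_w (cos (L w) * (expR (- (Z w ^+ 2 * s ^+ 2 / 2)) * F w)) =
    fine (\int[P]_w \int[N]_u (h (u, w))%:E)%E.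
  rewrite /Rintegral; congr fine; apply: eq_integral => w _.
  under eq_integral.
    move=> u _; rewrite /h/= (_ : _ * _ * _ = (cos (L w) * F w) * cos (Z w * u)); last by ring.
    rewrite EFinM; over.
  rewrite integralZl//=.
    by rewrite Rintegral_cos_normal_prob// -EFinM; congr EFin; ring.
  apply: measurable_bounded_integrable => //.
  - by apply: (le_lt_trans (probability_le1 N measurableT)); rewrite ltry.
  - exact: measurable_cosM.
  - exists 1; split => // z z1 u _ /=.
    exact: le_trans (norm_cos_le1 _) (ltW z1).
rewrite -(Fubini ih).
have iLu u : P.-integrable setT (EFin \o (fun w => cos (L w + u * Z w) * F w)).
  apply: (@bounded_integrable_prob _ 1).
    apply: measurable_funM => //; apply: measurableT_comp => //.
    by apply: measurable_funD => //; apply: measurable_funM.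
  by move=> w; rewrite normrM -[leRHS]mul1r ler_pM// norm_cos_le1.
(* The second cosine has frequency [- u], and [(a - u) ^ 2 = (- a + u) ^ 2]: it is the first bound
   with shift [- a]. Both shifts smooth to the same value, each with weight [C / 2]. *)
have inner u : (\int[P]_w (h (u, w))%:E <=
    (2^-1 * (C * expR (- (v * (a + u) ^+ 2 / 2)) +
       C * expR (- (v * (- a + u) ^+ 2 / 2))))%:E)%E.
  have -> : (\int[P]_w (h (u, w))%:E)%E =
      (2^-1 * (\int[P]_w (cos (L w + u * Z w) * F w) +
               \int[P]_w (cos (L w + (- u) * Z w) * F w)))%:E.
    rewrite -RintegralD// -RintegralZl//; last first.
      by have := integrableD measurableT (iLu u) (iLu (- u)).
    rewrite fineK; last first.
      apply: integrable_fin_num => //.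
      have := integrableZl measurableT (2^-1) (integrableD measurableT (iLu u) (iLu (- u))).
      exact.
    apply: eq_integral => w _; rewrite /h/=; congr EFin.
    by rewrite mulNr cosD cosB (mulrC u); field.
  rewrite lee_fin ler_pM2l// lerD// ?H//.
  by apply: (le_trans (H _)); rewrite -(sqrrN (a - u)) opprB addrC.
have smooth b : (\int[N]_u ((C / 2)%:E * (expR (- (v * (b + u) ^+ 2 / 2)))%:E) <=
    (C / 2 * (1 / (s * Num.sqrt v)))%:E)%E.
  rewrite ge0_integralZl//=.
  - rewrite (EFinM (C / 2) (1 / _)) lee_wpmul2l ?lee_fin ?divr_ge0//.
    exact: normal_smoothing.
  - apply/measurable_EFinP; apply: measurableT_comp => //; apply: measurableT_comp => //.
    apply: measurable_funM => //; apply: measurable_funM => //.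
    by apply: measurable_funX; apply: measurable_funD.
  - by rewrite lee_fin divr_ge0.
have mg (b : R) : measurable_fun setT (fun u : R => ((C / 2)%:E * (expR (- (v * (b + u) ^+ 2 / 2)))%:E)%E).
  apply: emeasurable_funM; first exact: measurable_cst.
  apply/measurable_EFinP; apply: measurableT_comp => //; apply: measurableT_comp => //.
  apply: measurable_funM => //; apply: measurable_funM => //.
  by apply: measurable_funX; apply: measurable_funD.
have ge (b u : R) : (0 <= (C / 2)%:E * (expR (- (v * (b + u) ^+ 2 / 2)))%:E)%E.
  by rewrite -EFinM lee_fin mulr_ge0 ?divr_ge0 ?expR_ge0.
rewrite -lee_fin fineK; last first.
  apply: integrable_fin_num => //; exact: (integrable_fubini_F ih).
apply: (@le_trans _ _ (\int[N]_u ((C / 2)%:E * (expR (- (v * (a + u) ^+ 2 / 2)))%:E +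
   (C / 2)%:E * (expR (- (v * (- a + u) ^+ 2 / 2)))%:E))%E).
  have iu (b : R) : N.-integrable setT (fun u : R => ((C / 2)%:E * (expR (- (v * (b + u) ^+ 2 / 2)))%:E)%E).
    apply/integrableP; split; first exact: mg.
    under eq_integral do rewrite gee0_abs//.
    exact: le_lt_trans (smooth b) (ltry _).
  apply: le_integral => //.
  - exact: (integrable_fubini_F ih).
  - exact: integrableD.
  - move=> u _; apply: (le_trans (inner u)).
    by rewrite -!EFinM -EFinD lee_fin le_eqVlt; apply/orP; left; apply/eqP; field.
rewrite ge0_integralD//; [|exact: mg..].
apply: (le_trans (leeD (smooth a) (smooth (- a)))).
rewrite -EFinD lee_fin le_eqVlt; apply/orP; left; apply/eqP; field.
by rewrite !gt_eqF// sqrtr_gt0.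
Qed.

End Gaussian.

Lemma sum_nat_delta (R : pzRingType) (m n x : nat) :
  \sum_(m <= i < n) (i == x)%:R = (m <= x < n)%N%:R :> R.
Proof.
rewrite (eq_bigr (fun i => if i == x then 1 else 0)); last by move=> i _; case: eqP.
by rewrite -big_mkcond big_nat1_eq; case: ifP.
Qed.

(** Jensen's inequality for the square: each term lies above the tangent at the mean [b], by
    [z ^ 2 >= 2 b z - b ^ 2]. *)
Lemma sum_sqr_ge_mean (R : realFieldType) (A : nat -> R) (y x : nat) (a : R) : (y < x)%N ->
  (x - y)%:R * ((\sum_(y <= z < x) A z) / (x - y)%:R + a) ^+ 2 <=
  \sum_(y <= z < x) (A z + a) ^+ 2.
Proof.
move=> yx; set n := (x - y)%:R; set b := _ / n + a.
have n0 : 0 < n by rewrite ltr0n subn_gt0.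
have -> : n * b ^+ 2 = \sum_(y <= z < x) (2 * b * (A z + a) - b ^+ 2).
  rewrite sumrB -mulr_sumr big_split/= !sumr_const_nat -(mulr_natl a) -(mulr_natl (b ^+ 2)) -/n.
  by rewrite /b; field; rewrite gt_eqF.
apply: ler_sum => z _; rewrite -subr_ge0.
by rewrite (_ : _ - _ = (A z + a - b) ^+ 2) ?sqr_ge0//; ring.
Qed.

(** * Moments of the number of near-zeros of a planar Gaussian walk *)

Section Joint.
Context {R : realType} (dT : measure_display) (T : measurableType dT).
Variable P : probability T R.
Variables (B1 B2 : nat -> T -> R) (k sg : R) (J : nat).
Hypothesis k0 : 0 < k.
Hypothesis sg0 : 0 < sg.
Hypothesis mB1 : forall x, measurable_fun setT (B1 x).
Hypothesis mB2 : forall x, measurable_fun setT (B2 x).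
Implicit Types (u : nat -> R) (pre : seq nat).

Definition lincomb u (B : nat -> T -> R) w := \sum_(0 <= x < J) u x * B x w.
(** Summation by parts: when [B 0 = 0], this is the coefficient of the increment [B (z + 1) - B z]
    in [lincomb]. Hence [k * tail_energy u1 u2 y] is the variance carried by the increments from [y]
    on. *)
Definition coef_tail u z := \sum_(z.+1 <= x < J) u x.
Definition tail_energy u1 u2 y :=
  \sum_(y <= z < J) (coef_tail u1 z ^+ 2 + coef_tail u2 z ^+ 2).

(* The grid increments [B_i (z + 1) - B_i z] are independent centered normals of
   variance [k], expressed through the characteristic function. *)
Hypothesis Bcos : forall u1 u2,
  \int[P]_w cos (lincomb u1 B1 w + lincomb u2 B2 w) =
  expR (- (k * tail_energy u1 u2 0 / 2)).

(** Smooth substitute for the indicator of [|B x| <= 1 / sg]. *)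
Definition kernel (B : nat -> T -> R) x w := expR (- (B x w ^+ 2 * sg ^+ 2 / 2)).
Definition hitw x w := kernel B1 x w * kernel B2 x w.
Definition hitprod pre w := \prod_(x <- pre) hitw x w.

(** The points of [pre] are listed in decreasing order, latest first; the default 0 of [head] is the
    starting time. Each factor has the order of the probability that a planar normal variable of
    variance [k] times the gap falls within [1 / sg] of a given point. *)
Fixpoint gapw pre : R :=
  if pre is x :: pre' then gapw pre' * ((sg ^+ 2 * k)^-1 / (x - head 0%N pre')%:R) else 1.

Lemma kernel_ge0 B x w : 0 <= kernel B x w. Proof. exact: expR_ge0. Qed.

Lemma kernel_le1 B x w : kernel B x w <= 1.
Proof. by rewrite -[leRHS]expR0 ler_expR oppr_le0 divr_ge0// mulr_ge0// sqr_ge0. Qed.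

Lemma measurable_kernel B x : measurable_fun setT (B x) -> measurable_fun setT (kernel B x).
Proof.
move=> mB; apply: measurableT_comp => //; apply: measurableT_comp => //.
apply: measurable_funM => //; apply: measurable_funM => //.
exact: measurable_funX.
Qed.

Lemma hitw_ge0 x w : 0 <= hitw x w.
Proof. by rewrite mulr_ge0 ?kernel_ge0. Qed.

Lemma hitw_le1 x w : hitw x w <= 1.
Proof. by rewrite -[leRHS]mul1r ler_pM ?kernel_ge0 ?kernel_le1. Qed.

Lemma measurable_hitw x : measurable_fun setT (hitw x).
Proof. by apply: measurable_funM; apply: measurable_kernel. Qed.

Lemma hitprod_ge0 pre w : 0 <= hitprod pre w.
Proof. by apply: prodr_ge0 => x _; exact: hitw_ge0. Qed.

Lemma hitprod_cons x pre w : hitprod (x :: pre) w = hitw x w * hitprod pre w.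
Proof. by rewrite /hitprod big_cons. Qed.

Lemma hitprod_le1 pre w : hitprod pre w <= 1.
Proof.
elim: pre => [|x pre IH]; first by rewrite /hitprod big_nil.
by rewrite hitprod_cons -[leRHS]mul1r ler_pM ?hitw_ge0 ?hitprod_ge0 ?hitw_le1.
Qed.

Lemma measurable_hitprod pre : measurable_fun setT (hitprod pre).
Proof.
elim: pre => [|x pre IH].
  rewrite (_ : hitprod _ = cst 1); first exact: measurable_cst.
  by apply/funext => w; rewrite /hitprod big_nil.
rewrite (_ : hitprod _ = fun w => hitw x w * hitprod pre w).
  by apply: measurable_funM => //; exact: measurable_hitw.
by apply/funext => w; rewrite hitprod_cons.
Qed.

Lemma gapw_ge0 pre : 0 <= gapw pre.
Proof.
elim: pre => //= x pre IH; rewrite mulr_ge0// divr_ge0// invr_ge0.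
by rewrite mulr_ge0 ?sqr_ge0// ltW.
Qed.

Lemma measurable_lincomb u B :
  (forall x, measurable_fun setT (B x)) -> measurable_fun setT (lincomb u B).
Proof.
move=> mB; rewrite /lincomb; apply: measurable_sum => x.
exact: measurable_funM.
Qed.

Definition add_at u x a : nat -> R := fun i => u i + a * (i == x)%:R.

Lemma lincomb_add_at u x a B w : (x < J)%N ->
  lincomb (add_at u x a) B w = lincomb u B w + a * B x w.
Proof.
move=> xJ; rewrite /lincomb /add_at.
under eq_bigr do rewrite mulrDl.
rewrite big_split/=; congr (_ + _).
under eq_bigr => i _.
  rewrite (_ : _ * _ = a * B x w * (i == x)%:R); last first.
    by have [->|] := eqVneq i x; rewrite ?mulr1// !mulr0 mul0r.
  over.
by rewrite -mulr_sumr sum_nat_delta leq0n xJ mulr1.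
Qed.

Lemma coef_tail_add_at u x a z : (x < J)%N ->
  coef_tail (add_at u x a) z = coef_tail u z + a * (z < x)%N%:R.
Proof.
move=> xJ; rewrite /coef_tail /add_at big_split/=; congr (_ + _).
by rewrite -mulr_sumr sum_nat_delta xJ andbT.
Qed.

(** A frequency added at [x] shifts the tail coefficients of the increments before [x] and no
    others. Between [y] and [x] only their mean is kept, so that the added frequency sits in a
    single square, ready for Gaussian averaging. *)
Lemma tail_energy_add_at_ge u1 u2 x y a b : (y < x)%N -> (x < J)%N ->
  tail_energy u1 u2 x +
  (x - y)%:R * ((\sum_(y <= z < x) coef_tail u1 z) / (x - y)%:R + a) ^+ 2 +
  (x - y)%:R * ((\sum_(y <= z < x) coef_tail u2 z) / (x - y)%:R + b) ^+ 2 <=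
  tail_energy (add_at u1 x a) (add_at u2 x b) y.
Proof.
move=> yx xJ.
rewrite {2}/tail_energy [leRHS](big_cat_nat (n := x))//=; try exact: ltnW.
rewrite -addrA addrC lerD//.
  rewrite [leRHS](_ : _ =
      \sum_(y <= z < x) (coef_tail u1 z + a) ^+ 2 + \sum_(y <= z < x) (coef_tail u2 z + b) ^+ 2).
    by rewrite lerD// sum_sqr_ge_mean.
  rewrite -big_split/=; apply: eq_big_nat => z /andP[_ zx].
  by rewrite !coef_tail_add_at// zx !mulr1.
rewrite le_eqVlt; apply/orP; left; apply/eqP; apply: eq_big_nat => z /andP[xz _].
by rewrite !coef_tail_add_at// ltnNge xz !mulr0 !addr0.
Qed.

(** Induction from the latest point. The frequencies are arbitrary because opening the kernels at
    [x] into cosines adds frequencies there. The energy after [x] goes through the induction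
    untouched, and that of the gap before [x] is spent on averaging over the new frequencies. *)
Lemma joint_cos_le pre m u1 u2 : (m <= J)%N -> path gtn m (rcons pre 0%N) ->
  \int[P]_w (cos (lincomb u1 B1 w + lincomb u2 B2 w) * hitprod pre w) <=
  gapw pre * expR (- (k * tail_energy u1 u2 (head 0%N pre) / 2)).
Proof.
elim: pre m u1 u2 => [|x pre IH] m u1 u2 mJ /=.
  move=> _; rewrite mul1r -Bcos.
  by under eq_Rintegral do rewrite /hitprod big_nil mulr1.
move=> /andP[xm pxp]; have xJ : (x < J)%N := leq_trans xm mJ.
have yx : (head 0%N pre < x)%N by case: (pre) pxp => [|? ?] /= /andP[].
set y := head 0%N pre in yx *.
pose n : R := (x - y)%:R; have n0 : 0 < n by rewrite ltr0n subn_gt0.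
have kn0 : 0 < k * n by rewrite mulr_gt0.
pose al := (\sum_(y <= z < x) coef_tail u1 z) / n.
pose be := (\sum_(y <= z < x) coef_tail u2 z) / n.
pose C := gapw pre * expR (- (k * tail_energy u1 u2 x / 2)).
have C0 : 0 <= C by rewrite mulr_ge0 ?gapw_ge0 ?expR_ge0.
have ml1 u := measurable_lincomb u mB1.
have ml2 u := measurable_lincomb u mB2.
have key a b : \int[P]_w (cos ((lincomb u1 B1 w + lincomb u2 B2 w + a * B1 x w) + b * B2 x w) *
    hitprod pre w) <=
    C * expR (- (k * n * (al + a) ^+ 2 / 2)) * expR (- (k * n * (be + b) ^+ 2 / 2)).
  have -> : \int[P]_w (cos ((lincomb u1 B1 w + lincomb u2 B2 w + a * B1 x w) + b * B2 x w) *
      hitprod pre w) =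
      \int[P]_w (cos (lincomb (add_at u1 x a) B1 w + lincomb (add_at u2 x b) B2 w) * hitprod pre w).
    apply: eq_Rintegral => w _; rewrite !lincomb_add_at//; congr (cos _ * _); ring.
  apply: (le_trans (IH x _ _ (ltnW xJ) pxp)).
  rewrite -/y /C -!(mulrA (gapw pre)) ler_wpM2l ?gapw_ge0// -!expRD ler_expR.
  have := ler_wpM2l (ltW k0) (tail_energy_add_at_ge u1 u2 a b yx xJ).
  rewrite -/n -/al -/be.
  move: (tail_energy _ _ _) (tail_energy _ _ _) ((al + a) ^+ 2) ((be + b) ^+ 2) => E1 E2 A2 B2'.
  clearbody n; lra.
(* The frequency [b] is averaged out with [a] held inside the cosine, and [a] afterwards. Each costs
   [1 / (sg * sqrt (k n))]; together they make the gap weight of [x]. *)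
have step1 a : \int[P]_w (cos (lincomb u1 B1 w + lincomb u2 B2 w + a * B1 x w) *
    (kernel B2 x w * hitprod pre w)) <=
    C * (1 / (sg * Num.sqrt (k * n))) * expR (- (k * n * (al + a) ^+ 2 / 2)).
  rewrite mulrAC.
  apply: (@cos_gaussian_kernel_le _ _ _ P
    (fun w => lincomb u1 B1 w + lincomb u2 B2 w + a * B1 x w)
    (B2 x) (hitprod pre) sg (k * n) be) => //.
  - by rewrite mulr_ge0 ?expR_ge0.
  - by apply: measurable_funD; [exact: measurable_funD|exact: measurable_funM].
  - exact: measurable_hitprod.
  - by move=> w; rewrite ger0_norm ?hitprod_ge0 ?hitprod_le1.
have := @cos_gaussian_kernel_le _ _ _ P
    (fun w => lincomb u1 B1 w + lincomb u2 B2 w)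
    (B1 x) (fun w => kernel B2 x w * hitprod pre w) sg (k * n) al
    (C * (1 / (sg * Num.sqrt (k * n)))) sg0 kn0.
have -> : \int[P]_w (cos (lincomb u1 B1 w + lincomb u2 B2 w) * hitprod (x :: pre) w) =
    \int[P]_w (cos (lincomb u1 B1 w + lincomb u2 B2 w) *
      (expR (- (B1 x w ^+ 2 * sg ^+ 2 / 2)) * (kernel B2 x w * hitprod pre w))).
  by apply: eq_Rintegral => w _; rewrite hitprod_cons /hitw -(mulrA (kernel B1 x w)).
move=> H; apply: (le_trans (H _ _ _ _ _ _)) => //.
- by apply: mulr_ge0 => //; rewrite divr_ge0// mulr_ge0 ?sqrtr_ge0// ltW.
- exact: measurable_funD.
- by apply: measurable_funM; [exact: measurable_kernel|exact: measurable_hitprod].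
- move=> w; rewrite ger0_norm ?mulr_ge0 ?kernel_ge0 ?hitprod_ge0//.
  by rewrite -[leRHS]mul1r ler_pM ?kernel_ge0 ?kernel_le1 ?hitprod_ge0 ?hitprod_le1.
rewrite le_eqVlt; apply/orP; left; apply/eqP; rewrite /C -/n.
have sq0 : Num.sqrt (k * n) != 0 by rewrite gt_eqF// sqrtr_gt0.
have sq2 : Num.sqrt (k * n) * Num.sqrt (k * n) = k * n by rewrite -expr2 sqr_sqrtr// ltW.
rewrite -mulrA (_ : 1 / _ * (1 / _) = (sg ^+ 2 * k)^-1 / n); first by ring.
transitivity (sg ^+ 2 * (Num.sqrt (k * n) * Num.sqrt (k * n)))^-1.
  by field; rewrite sq0 gt_eqF.
by rewrite sq2; field; rewrite !gt_eqF.
Qed.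


(** The elementary symmetric polynomial of degree [n] in the weights of the points strictly between
    [p] and [J]. *)
Fixpoint chains n p w : R :=
  if n is n'.+1 then \sum_(p.+1 <= x < J) hitw x w * chains n' x w else 1.

Lemma chains_ge0 n p w : 0 <= chains n p w.
Proof.
elim: n p => //= n IH p; apply: sumr_ge0 => x _.
by rewrite mulr_ge0 ?hitw_ge0.
Qed.

Lemma measurable_chains n p : measurable_fun setT (chains n p).
Proof.
elim: n p => [|n IH] p; first exact: measurable_cst.
rewrite /=; apply: measurable_sum => x.
by apply: measurable_funM => //; exact: measurable_hitw.
Qed.

(** Bounds the total gap weight of the next point, wherever the previous one is. This harmonic sum
    is the source of the logarithm. *)
Definition gapsum : R := \sum_(1 <= x < J) (sg ^+ 2 * k)^-1 / x%:R.

Lemma gap_ge0 x : 0 <= (sg ^+ 2 * k)^-1 / x%:R.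
Proof. by rewrite divr_ge0// invr_ge0 mulr_ge0 ?sqr_ge0// ltW. Qed.

Lemma gapsum_ge0 : 0 <= gapsum.
Proof. by apply: sumr_ge0 => x _; exact: gap_ge0. Qed.

Lemma gapsum_shift p : \sum_(p.+1 <= x < J) (sg ^+ 2 * k)^-1 / (x - p)%:R <= gapsum.
Proof.
rewrite /gapsum -(add1n p) big_addn.
under eq_bigr do rewrite addnK.
have [le|/ltnW le] := leqP 1 (J - p).
  rewrite [leRHS](big_cat_nat (n := J - p))//= ?leq_subr// lerDl.
  by apply: sumr_ge0 => x _; exact: gap_ge0.
by rewrite big_geq// gapsum_ge0.
Qed.

Lemma integral_hitprod_le pre : path gtn J (rcons pre 0%N) ->
  (\int[P]_w (hitprod pre w)%:E <= (gapw pre)%:E)%E.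
Proof.
move=> Jpre; have := @joint_cos_le pre J (cst 0) (cst 0) (leqnn _) Jpre.
have l0 B w : lincomb (cst 0) B w = 0.
  by rewrite /lincomb big1// => i _; rewrite mul0r.
under eq_Rintegral do rewrite !l0 addr0 cos0 mul1r.
have -> : tail_energy (cst 0) (cst 0) (head 0%N pre) = 0.
  rewrite /tail_energy big1// => i _.
  by rewrite /coef_tail big1// expr0n/= addr0.
rewrite mulr0 mul0r oppr0 expR0 mulr1 -lee_fin /Rintegral fineK//.
apply: integrable_fin_num => //; apply: (@bounded_integrable_prob _ _ _ P _ 1).
  exact: measurable_hitprod.
by move=> w; rewrite ger0_norm ?hitprod_ge0 ?hitprod_le1.
Qed.

(** Generalised over the points already chosen: each next point [x] moves into [pre], and the sum of
    its gap weights is at most [gapsum]. *)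
Lemma integral_chains_le n pre : path gtn J (rcons pre 0%N) ->
  (\int[P]_w (hitprod pre w * chains n (head 0%N pre) w)%:E <=
   (gapw pre * gapsum ^+ n)%:E)%E.
Proof.
elim: n pre => [|n IH] pre Jpre.
  rewrite expr0 mulr1; under eq_integral do rewrite /= mulr1.
  exact: integral_hitprod_le.
set p := head 0%N pre.
under eq_integral.
  move=> w _; rewrite /= mulr_sumr -sumEFin; over.
rewrite ge0_integral_sum//=; last 2 first.
- move=> x; apply/measurable_EFinP; apply: measurable_funM.
    exact: measurable_hitprod.
  by apply: measurable_funM; [exact: measurable_hitw|exact: measurable_chains].
- by move=> x w _; rewrite lee_fin mulr_ge0 ?hitprod_ge0// mulr_ge0 ?hitw_ge0 ?chains_ge0.
apply: (@le_trans _ _ (\sum_(p.+1 <= x < J)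
  (gapw pre * ((sg ^+ 2 * k)^-1 / (x - p)%:R) * gapsum ^+ n)%:E)%E).
  rewrite big_nat_cond [leRHS]big_nat_cond; apply: lee_sum => x.
  rewrite andbT => /andP[px xJ].
  have Jxpre : path gtn J (rcons (x :: pre) 0%N).
    rewrite /= xJ /=; move: px Jpre; rewrite /p.
    by case: (pre) => [|q s] /=; [move=> -> |move=> -> /andP[]].
  apply: le_trans (IH _ Jxpre); rewrite le_eqVlt; apply/orP; left; apply/eqP.
  apply: eq_integral => w _; rewrite hitprod_cons /=; congr EFin; ring.
rewrite sumEFin lee_fin -mulr_suml -mulr_sumr (exprS gapsum) (mulrA (gapw pre)).
by rewrite ler_wpM2r ?exprn_ge0 ?gapsum_ge0// ler_wpM2l ?gapw_ge0 ?gapsum_shift.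
Qed.

Lemma prob_chains_le n (t : R) : 0 < t -> (0 < J)%N ->
  (P [set w | (t <= chains n 0 w)%R] <= (gapsum ^+ n / t)%:E)%E.
Proof.
move=> t0 J0; set A := [set w | _].
have mA : measurable A by apply: measurable_superlevel; exact: measurable_chains.
have J0' : path gtn J (rcons [::] 0%N) by rewrite /= andbT.
have := integral_chains_le n J0'; rewrite /= mul1r.
under eq_integral do rewrite /hitprod big_nil mul1r.
move=> h; rewrite EFinM lee_pdivlMr// muleC.
apply: le_trans h; rewrite -(integral_cst P mA t%:E).
apply: (@le_trans _ _ (\int[P]_(w in A) (chains n 0 w)%:E)%E).
  apply: ge0_le_integral => //=.
  - by move=> w _; rewrite lee_fin ltW.
  - by apply/measurable_EFinP; apply: measurable_funTS; exact: measurable_chains.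
apply: ge0_subset_integral => //=.
- by apply/measurable_EFinP; exact: measurable_chains.
- by move=> w _; rewrite lee_fin chains_ge0.
Qed.

(* Pascal's rule, splitting on whether [p.+1] is the first point of the chain. *)
Lemma chains_ge_binomial (e : R) (hit : pred nat) w n p : 0 <= e ->
  (forall x, hit x -> e <= hitw x w) ->
  e ^+ n * 'C(\sum_(p.+1 <= x < J) hit x, n)%:R <= chains n p w.
Proof.
move=> e0 he.
have : (J <= p.+1 + (J - p.+1))%N by rewrite -leq_subLR.
move: (J - p.+1)%N => d; elim: d p n => [|d IH] p [|n] Jp.
- by rewrite bin0 expr0 mulr1.
- rewrite /= !big_geq ?bin0n ?mulr0//; by rewrite addn0 in Jp.
- by rewrite bin0 expr0 mulr1.
have [Jp1|pJ] := leqP J p.+1.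
  by rewrite /= !big_geq// bin0n mulr0.
have Jp' : (J <= p.+2 + d)%N by rewrite addSnnS.
rewrite big_ltn//= [leRHS]big_ltn//.
have hD := IH p.+1 n.+1 Jp'; have hC := IH p.+1 n Jp'.
have [hp|_] := boolP (hit p.+1).
  rewrite add1n binS natrD mulrDr addrC lerD//.
  by rewrite exprS -mulrA ler_pM ?he// mulr_ge0 ?exprn_ge0.
rewrite add0n; apply: (le_trans hD).
by rewrite lerDr mulr_ge0 ?hitw_ge0 ?chains_ge0.
Qed.

End Joint.

(** The right side is the product of the [n] integers from [m + 1] to [m + n]. *)
Lemma expn_le_binM (n m : nat) : (m ^ n <= 'C(n + m, n) * n`!)%N.
Proof.
rewrite bin_ffact.
elim: n => [|n IH]; first by rewrite expn0 ffactn0.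
by rewrite addSn ffactSS expnS leq_mul// leqW// leq_addl.
Qed.

(** * Covers and Hausdorff dimension zero *)

Section Hausdorff.
Context {R : realType}.
Implicit Types (al de : R) (E U : set (R * R)).

(** Vanishing Hausdorff content at scale [de], with explicit covers; this form passes to countable
    unions. *)
Definition small_cover al de E := forall e : R, 0 < e ->
  exists U : nat -> set (R * R), [/\ E `<=` \bigcup_n U n,
    forall n x y, U n x -> U n y -> edist2 x y <= de &
    (\sum_(0 <= n <oo) (cover_term al (U n))%:E <= e%:E)%E].

Lemma cover_term_ge0 al U : 0 <= cover_term al U.
Proof. by rewrite /cover_term; case: ifP => // _; exact: powR_ge0. Qed.

Lemma cover_term0 al : cover_term al set0 = 0 :> R.
Proof. by rewrite /cover_term; case: asboolP. Qed.

Lemma cover_term_le al U (h : R) : 0 < al -> 0 <= h ->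
  (forall x y, U x -> U y -> edist2 x y <= h) -> cover_term al U <= h `^ al.
Proof.
move=> al0 h0 Uh; rewrite /cover_term; case: ifP => [_|_]; first exact: powR_ge0.
have le : (diam2 U <= h%:E)%E.
  apply: ge_ereal_sup => _ [->|[x Ux [y Uy <-]]]; first by rewrite lee_fin.
  by rewrite lee_fin Uh.
have ge : (0 <= diam2 U)%E by apply: ereal_sup_ubound; left.
have fd : diam2 U \is a fin_num by rewrite ge0_fin_numE// (le_lt_trans le) ?ltry.
apply: ge0_ler_powR; rewrite ?nnegrE ?fine_ge0//; first exact: ltW.
by rewrite -lee_fin fineK.
Qed.

(** The set [E M] receives the budget [e / 2 ^ (M + 1)], and the double sequence of covers is
    enumerated through a bijection of [nat] with [nat * nat]. *)
Lemma small_cover_bigcup al de (E : nat -> set (R * R)) :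
  (forall M, small_cover al de (E M)) -> small_cover al de (\bigcup_M E M).
Proof.
move=> cE e e0.
have e0M M : 0 < e / (2 ^ M.+1)%:R by rewrite divr_gt0// ltr0n expn_gt0.
have [G PG] := choice (fun M => cE M _ (e0M M)).
have /card_esym/ppcard_eqP[f] := card_nat2.
exists (fun n => G (f n).1 (f n).2); split.
- move=> x [M _ EMx]; have [GM _ _] := PG M.
  have [j _ Gx] := GM x EMx.
  by exists (f^-1%FUN (M, j)) => //=; rewrite invK ?inE.
- by move=> n x y; have [_ + _] := PG (f n).1; apply.
- pose c M j := (cover_term al (G M j))%:E.
  have c0 M j : (0 <= c M j)%E by rewrite lee_fin cover_term_ge0.
  rewrite nneseries_esumT//; last by move=> n; exact: c0.
  rewrite -(reindex_esum [set: nat] [set: nat * nat] f (fun p => c p.1 p.2)); last exact: bij.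
  have -> : (\esum_(p in [set: nat * nat]) c p.1 p.2 = \sum_(M <oo) \sum_(j <oo) c M j)%E.
    rewrite nneseries_esumT; last by move=> M; exact: nneseries_ge0.
    under [RHS]eq_esum do rewrite nneseries_esumT//.
    rewrite esum_esum//; congr esum.
    by apply/seteqP; split.
  apply: le_trans (epsilon_trick0 xpredT (ltW e0)).
  apply: lee_nneseries => [M *|M *]; first exact: nneseries_ge0.
  by have [_ _] := PG M.
Qed.

Lemma small_cover_content0 al de E : small_cover al de E -> hausdorff_content al de E = 0%E.
Proof.
move=> cE; apply/eqP; rewrite eq_le; apply/andP; split; last first.
  apply: le_ereal_inf_tmp => _ [U _ <-]; apply: nneseries_ge0 => n _ _.
  by rewrite lee_fin cover_term_ge0.
apply/lee_addgt0Pr => e e0; rewrite add0e.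
have [U [EU Ude Ue]] := cE e e0.
by apply: (le_trans _ Ue); apply: ereal_inf_lbound; exists U.
Qed.

Lemma hausdorff_dim0 E :
  (forall al de, 0 < al -> 0 < de -> small_cover al de E) -> hausdorff_dim E = 0%E.
Proof.
move=> cE; apply/eqP; rewrite eq_le; apply/andP; split; last first.
  by apply: le_ereal_inf_tmp => _ [al [al0 _] <-]; rewrite lee_fin.
apply/lee_addgt0Pr => e e0; rewrite add0e.
apply: ereal_inf_lbound; exists e => //; split; first exact: ltW.
rewrite /hausdorff_measure (_ : [set _ | de in _] = [set 0%E]) ?ereal_sup1//.
apply/seteqP; split => [_ [de de0 <-]|_ ->] /=.
  exact/small_cover_content0/cE.
by exists 1 => //=; apply: small_cover_content0; exact: cE.
Qed.

(** Distances within a slice are distances in time, so a time cell of length [h] yields a set of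
    diameter at most [h]. Cells without a point of [Z] cost 0, and [K] bounds the number of the
    others. *)
Lemma small_cover_slice (s : R) (Z : set R) (al de h : R) (K e : R) :
  0 < al -> 0 < h -> h <= de -> (forall t, Z t -> 0 <= t) ->
  (forall n, \sum_(0 <= j < n) (`[< exists2 t, Z t & Num.truncn (t / h) = j >] : nat)%:R <= K) ->
  K * h `^ al <= e ->
  exists U : nat -> set (R * R), [/\ [set p | p.1 = s /\ Z p.2] `<=` \bigcup_n U n,
    forall n x y, U n x -> U n y -> edist2 x y <= de &
    (\sum_(0 <= n <oo) (cover_term al (U n))%:E <= e%:E)%E].
Proof.
move=> al0 h0 hde Z0 ZK Ke.
pose U j := [set p : R * R | [/\ p.1 = s, Z p.2 & Num.truncn (p.2 / h) = j]].
have Uh j x y : U j x -> U j y -> edist2 x y <= h.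
  move=> [x1 Zx xj] [y1 Zy yj]; rewrite /edist2 x1 y1 subrr expr0n add0r sqrtr_sqr.
  have := @truncn_itv _ (x.2 / h); have := @truncn_itv _ (y.2 / h).
  rewrite xj yj => /(_ (divr_ge0 (Z0 _ Zy) (ltW h0))) /andP[y_ge y_lt].
  move=> /(_ (divr_ge0 (Z0 _ Zx) (ltW h0))) /andP[x_ge x_lt].
  move: y_ge y_lt x_ge x_lt; rewrite !ler_pdivlMr// !ltr_pdivrMr// -natr1 mulrDl mul1r.
  move: (j%:R * h) => jh ? ? ? ?; rewrite ler_norml; apply/andP; split; lra.
exists U; split.
- by move=> p [p1 Zp]; exists (Num.truncn (p.2 / h)).
- by move=> j x y Ux Uy; exact: le_trans (Uh j x y Ux Uy) hde.
apply: lime_le.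
  by apply: is_cvg_nneseries => n _ _; rewrite lee_fin cover_term_ge0.
apply: nearW => n; rewrite sumEFin lee_fin; apply: le_trans Ke.
apply: le_trans (ler_wpM2r (powR_ge0 _ _) (ZK n)); rewrite mulr_suml.
apply: ler_sum => j _; case: asboolP => [_|nZ].
  by rewrite mul1r; apply: cover_term_le => //; [exact: ltW|exact: Uh].
rewrite mul0r (_ : U j = set0) ?cover_term0//.
apply/seteqP; split => // p [_ Zp pj]; apply: nZ; by exists p.2.
Qed.

End Hausdorff.

(** * Chaining over the grids: from a point to the corner of its cell *)

Section Chaining.
Context {R : realType}.
Variables (f : R -> R -> R) (b q : nat) (tau : R).
Hypothesis b1 : (1 < b)%N.
Hypothesis tau0 : 0 <= tau.
Hypothesis tau2 : 2 * tau <= 1.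
Hypothesis cf : {within [set p : R * R | 0 <= p.1 /\ 0 <= p.2],
  continuous (fun p => f p.1 p.2)}.

Definition gridval m i j := f (i%:R / b%:R ^+ m) (j%:R / b%:R ^+ m).

Definition small_increments m := forall i j, (i <= q * b ^ m)%N -> (j <= q * b ^ m)%N ->
  `|gridval m i.+1 j - gridval m i j| <= tau ^+ m /\
  `|gridval m i j.+1 - gridval m i j| <= tau ^+ m.

Let cell (m : nat) (s : R) := Num.truncn (s * b%:R ^+ m).

Let b0 : 0 < b%:R :> R. Proof. by rewrite ltr0n ltnW. Qed.

Let cell_itv m s : 0 <= s -> (cell m s)%:R <= s * b%:R ^+ m < (cell m s).+1%:R.
Proof. by move=> s0; apply: truncn_itv; rewrite mulr_ge0// exprn_ge0// ltW. Qed.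

Let cell_lt m s : 0 <= s -> s < q%:R -> (cell m s < q * b ^ m)%N.
Proof.
move=> s0 sq; have /andP[le _] := cell_itv m s0.
rewrite -(ltr_nat R) (le_lt_trans le)// natrM natrX ltr_pM2r//.
by rewrite exprn_gt0.
Qed.

Let cellS m s : 0 <= s -> exists2 p, (p <= b)%N & cell m.+1 s = (cell m s * b + p)%N.
Proof.
move=> s0; have /andP[l1 l2] := cell_itv m s0; have /andP[r1 r2] := cell_itv m.+1 s0.
have h1 : (cell m s * b <= cell m.+1 s)%N.
  rewrite -ltnS -(ltr_nat R); apply: le_lt_trans r2.
  by rewrite natrM exprSr mulrA ler_pM2r.
exists (cell m.+1 s - cell m s * b)%N; last by rewrite subnKC.
rewrite leq_subLR -ltnS -(ltr_nat R).
apply: (le_lt_trans r1); apply: (@lt_trans _ _ ((cell m s).+1%:R * b%:R)).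
  by rewrite exprSr mulrA ltr_pM2r.
by rewrite -natrM mulSn ltr_nat addnC.
Qed.

Lemma gridval_refine m i j : gridval m.+1 (i * b) (j * b) = gridval m i j.
Proof.
rewrite /gridval !natrM exprSr; congr f; field;
  by rewrite (gt_eqF b0) expf_neq0 ?(gt_eqF b0).
Qed.

Let walk1 m i j p : small_increments m -> (j <= q * b ^ m)%N -> (i + p <= q * b ^ m)%N ->
  `|gridval m (i + p) j - gridval m i j| <= p%:R * tau ^+ m.
Proof.
move=> sm jq; elim: p => [|p IH] ip; first by rewrite addn0 subrr normr0 mul0r.
rewrite addnS in ip *; have [h _] := sm (i + p)%N j (ltnW ip) jq.
rewrite -natr1 mulrDl mul1r.
apply: le_trans (ler_distD (gridval m (i + p) j) _ _) _.
by rewrite addrC lerD// IH// ltnW.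
Qed.

Let walk2 m i j p : small_increments m -> (i <= q * b ^ m)%N -> (j + p <= q * b ^ m)%N ->
  `|gridval m i (j + p) - gridval m i j| <= p%:R * tau ^+ m.
Proof.
move=> sm jq; elim: p => [|p IH] ip; first by rewrite addn0 subrr normr0 mul0r.
rewrite addnS in ip *; have [_ h] := sm i (j + p)%N jq (ltnW ip).
rewrite -natr1 mulrDl mul1r.
apply: le_trans (ler_distD (gridval m i (j + p)) _ _) _.
by rewrite addrC lerD// IH// ltnW.
Qed.

Variables (m0 : nat) (s t : R).
Hypothesis sm : forall m, (m0 <= m)%N -> small_increments m.
Hypothesis s0 : 0 <= s.
Hypothesis t0 : 0 <= t.
Hypothesis sq : s < q%:R.
Hypothesis tq : t < q%:R.

Let a m := gridval m (cell m s) (cell m t).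

(** The coarse corner is also a point of the fine grid, and the fine corner lies at most [b] fine
    steps away in each of the two directions. *)
Let step m : (m0 <= m)%N -> `|a m.+1 - a m| <= 2 * b%:R * tau ^+ m.+1.
Proof.
move=> mm; rewrite /a -(gridval_refine m (cell m s)).
have [p pb ep] := cellS m s0; have [p' pb' ep'] := cellS m t0.
have sp := cell_lt m.+1 s0 sq; have tp := cell_lt m.+1 t0 tq.
rewrite ep ep' in sp tp *.
have m1 : small_increments m.+1 by apply: sm; exact: leqW.
have tau1 : 0 <= tau ^+ m.+1 by rewrite exprn_ge0.
apply: le_trans (ler_distD (gridval m.+1 (cell m s * b) (cell m t * b + p')) _ _) _.
rewrite mulr_natl mulr2n mulrDl lerD//.
  apply: (le_trans (walk1 m1 (ltnW tp) (ltnW sp))).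
  by rewrite ler_wpM2r// ler_nat.
apply: (le_trans (walk2 m1 _ (ltnW tp))).
  by apply: leq_trans (ltnW sp); exact: leq_addr.
by rewrite ler_wpM2r// ler_nat.
Qed.

(** As [2 * tau <= 1], each term [tau ^+ k.+1] is at most [tau ^+ k - tau ^+ k.+1]; the geometric
    series telescopes. *)
Let steps m n : (m0 <= m)%N ->
  `|a (m + n) - a m| <= 2 * b%:R * (tau ^+ m - tau ^+ (m + n)).
Proof.
move=> mm; elim: n => [|n IH]; first by rewrite addn0 !subrr normr0 mulr0.
apply: le_trans (ler_distD (a (m + n)) _ _) _.
rewrite addnS addrC; apply: (le_trans (lerD IH (step _))).
  by rewrite (leq_trans mm)// leq_addr.
rewrite -mulrDr ler_wpM2l ?mulr_ge0//.
have : 0 <= tau ^+ (m + n) by rewrite exprn_ge0.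
rewrite exprS; move: (tau ^+ (m + n)) (tau ^+ m) => x y x0.
have := ler_wpM2l x0 tau2; lra.
Qed.

(** Continuity holds only relative to the quadrant; rounding down a nonnegative coordinate keeps the
    corner inside it. *)
Let near_cell (e : R) : 0 < e -> exists n0, forall n, (n0 <= n)%N -> `|f s t - a n| < e.
Proof.
move=> e0; move/subspace_continuousP : cf => /(_ (s, t) (conj s0 t0)).
move=> /cvgrPdist_lt/(_ e e0)/= h.
have [d /= d0 hd] : exists2 d : R, 0 < d & forall p : R * R, `|s - p.1| < d -> `|t - p.2| < d ->
    0 <= p.1 -> 0 <= p.2 -> `|f s t - f p.1 p.2| < e.
  move: h; rewrite near_withinE => /nbhs_ballP[d /= d0 hd].
  exists d => // p p1 p2 p10 p20; by apply: (hd p); split.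
have [n0 hn0] : exists n0, forall n, (n0 <= n)%N -> (b%:R ^+ n)^-1 < d.
  exists (Num.truncn d^-1).+1 => n hn.
  rewrite -[ltRHS]invrK ltf_pV2 ?posrE ?invr_gt0 ?exprn_gt0//.
  apply: (lt_trans (truncnS_gt _)).
  rewrite -natrX ltr_nat; apply: (leq_trans _ (ltn_expl n b1)).
  by rewrite ltnS.
exists n0 => n nn.
have ck (u : R) : 0 <= u -> 0 <= (cell n u)%:R / b%:R ^+ n :> R /\
    `|u - (cell n u)%:R / b%:R ^+ n| < d.
  move=> u0; have bn0 : 0 < b%:R ^+ n :> R by rewrite exprn_gt0.
  have /andP[l1 l2] := cell_itv n u0.
  split; first by rewrite divr_ge0// ltW.
  apply: lt_trans (hn0 n nn).
  rewrite ger0_norm ?subr_ge0 ?ler_pdivrMr//.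
  rewrite ltrBlDr -[X in X + _]mul1r -mulrDl ltr_pdivlMr//.
  by rewrite -natr1 addrC in l2.
have [c1 c2] := ck s s0; have [c3 c4] := ck t t0.
exact: (hd ((cell n s)%:R / b%:R ^+ n, (cell n t)%:R / b%:R ^+ n)).
Qed.

(** Limit along the cells shrinking to [(s, t)]. At a zero of [f] it bounds the value at the corner,
    which is how zeros become hits. *)
Lemma gridval_close m : (m0 <= m)%N ->
  `|f s t - gridval m (Num.truncn (s * b%:R ^+ m)) (Num.truncn (t * b%:R ^+ m))| <=
  2 * b%:R * tau ^+ m.
Proof.
move=> mm; apply/ler_addgt0Pr => e e0.
have [n0 hn0] := near_cell e0.
have := hn0 (m + n0)%N (leq_addl _ _); have := steps n0 mm.
have : 0 <= 2 * b%:R * tau ^+ (m + n0) by rewrite !mulr_ge0 ?exprn_ge0.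
rewrite mulrBr -/(cell m s) -/(cell m t) -/(a m).
have := ler_distD (a (m + n0)) (f s t) (a m).
move: (`|_|) (`|_|) (`|_|) (2 * b%:R * _) (2 * b%:R * _) => *; lra.
Qed.

End Chaining.

(** * Gaussian facts about the Brownian sheet *)

Section Sheet.
Context {R : realType} (dT : measure_display) (T : measurableType dT).
Variables (P : probability T R) (d : nat) (B : 'I_d -> R -> R -> T -> R).
Hypothesis hB : brownian_sheet P B.

Lemma sheet_measurable i (s t : R) : 0 <= s -> 0 <= t -> measurable_fun setT (B i s t).
Proof. by case: hB => + _; apply. Qed.

(** Moves the Gaussian clause to any finite index type, so that two coordinates can be indexed by a
    sum type and a difference by [bool]. *)
Lemma sheet_linear_comb (I : finType) (idx : I -> 'I_d) (s t a : I -> R) :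
  (forall k, 0 <= s k /\ 0 <= t k) ->
  centered_normal P (fun w => \sum_k a k * B (idx k) (s k) (t k) w)
    (\sum_k \sum_l a k * a l * (Num.min (s k) (s l) * Num.min (t k) (t l))
       * (idx k == idx l)%:R).
Proof.
move=> st0; have [_ [_ gauss]] := hB.
have sumE (F : I -> R) : \sum_(k < #|I|) F (enum_val k) = \sum_k F k.
  by rewrite [RHS](reindex _ (onW_bij _ (enum_val_bij I))).
have := gauss #|I| (idx \o enum_val) (s \o enum_val) (t \o enum_val) (a \o enum_val)
  (fun k => st0 (enum_val k)).
rewrite /comp; under eq_fun do rewrite (sumE (fun k => a k * B (idx k) (s k) (t k) _)).
rewrite (sumE (fun k => \sum_l a k * a (enum_val l) * (Num.min (s k) (s (enum_val l)) *
  Num.min (t k) (t (enum_val l))) * (idx k == idx (enum_val l))%:R)).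
under eq_bigr do rewrite (sumE (fun l => a _ * a l * (Num.min (s _) (s l) *
  Num.min (t _) (t l)) * (idx _ == idx l)%:R)).
by [].
Qed.

(** [minn x y] counts the [z] below both [x] and [y]; exchanging sums turns the covariance form into
    a sum of squares. *)
Lemma sum_min_quadratic (J : nat) (u : nat -> R) :
  \sum_(x < J) \sum_(y < J) u x * u y * (minn x y)%:R =
  \sum_(0 <= z < J) coef_tail J u z ^+ 2.
Proof.
have tailE z : coef_tail J u z = \sum_(x < J) u x * (z < x)%N%:R.
  rewrite -(big_mkord xpredT (fun x => u x * (z < x)%N%:R)) /coef_tail.
  have [zJ|Jz] := ltnP z J.
    rewrite [RHS](big_cat_nat (n := z.+1))//= [X in _ = X + _]big_nat [X in _ = X + _]big1; last first.
      by move=> x /andP[_ xz]; rewrite ltnNge -ltnS xz mulr0.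
    by rewrite add0r; apply: eq_big_nat => x /andP[-> _]; rewrite mulr1.
  rewrite [LHS]big_geq ?leqW//.
  rewrite big_nat big1// => x /andP[_ xJ].
  by rewrite ltnNge (leq_trans (ltnW xJ) Jz) mulr0.
have minE (x y : 'I_J) : (minn x y)%:R = \sum_(0 <= z < J) ((z < x)%N%:R * (z < y)%N%:R) :> R.
  have mJ : (minn x y <= J)%N by rewrite geq_min ltnW.
  rewrite (big_cat_nat (n := minn x y))//= [X in _ = _ + X]big_nat [X in _ = _ + X]big1 ?addr0; last first.
    by move=> z /andP[+ _]; rewrite geq_min => /orP[];
      rewrite leqNgt => /negbTE ->; rewrite ?mul0r ?mulr0.
  rewrite (eq_big_nat _ _ (F2 := fun=> 1)).
    by rewrite sumr_const_nat subn0.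
  by move=> z /andP[_]; rewrite leq_min => /andP[-> ->]; rewrite mulr1.
under eq_bigr do under eq_bigr do rewrite minE mulr_sumr.
under eq_bigr do rewrite exchange_big/=.
rewrite exchange_big/=; apply: eq_bigr => z _.
rewrite tailE expr2 mulr_suml; apply: eq_bigr => x _.
rewrite mulr_sumr; apply: eq_bigr => y _; ring.
Qed.

(** For fixed [S] each coordinate is in [t] a Brownian motion of speed [S], and distinct coordinates
    are uncorrelated. This is the cosine hypothesis of the moment bounds, with [k = S / D] the
    variance of one grid increment. *)
Lemma sheet_grid_charfun (c1 c2 : 'I_d) (S D : R) (J : nat) (u1 u2 : nat -> R) :
  c1 != c2 -> 0 <= S -> 0 < D ->
  \int[P]_w cos (lincomb J u1 (fun x => B c1 S (x%:R / D)) w +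
                 lincomb J u2 (fun x => B c2 S (x%:R / D)) w) =
  expR (- (S / D * tail_energy J u1 u2 0 / 2)).
Proof.
move=> c12 S0 D0.
pose idx (k : 'I_J + 'I_J) := if k is inl _ then c1 else c2.
pose pos (k : 'I_J + 'I_J) : nat := match k with inl x => x | inr x => x end.
pose co (k : 'I_J + 'I_J) := match k with inl x => u1 x | inr x => u2 x end.
have pos0 x : 0 <= x%:R / D by rewrite divr_ge0// ltW.
have := @sheet_linear_comb ('I_J + 'I_J)%type idx (fun=> S) (fun k => (pos k)%:R / D) co
  (fun k => conj S0 (pos0 (pos k))).
have mX : measurable_fun setT (fun w => \sum_k co k * B (idx k) S ((pos k)%:R / D) w).
  apply: measurable_sum => k; apply: measurable_funM => //.
  exact: sheet_measurable.
have minE x y : Num.min (x%:R / D) (y%:R / D) = (minn x y)%:R / D.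
  have [xy|/ltnW yx] := leqP x y.
    by rewrite min_l// ler_pM2r ?invr_gt0// ler_nat.
  by rewrite min_r// ler_pM2r ?invr_gt0// ler_nat.
set v := (X in centered_normal _ _ X).
have vE : v = S / D * tail_energy J u1 u2 0.
  rewrite /v big_sumType/= /tail_energy big_split/= mulrDr -!sum_min_quadratic.
  congr (_ + _); rewrite mulr_sumr; apply: eq_bigr => x _; rewrite big_sumType/=.
    rewrite [X in _ + X]big1 ?addr0; last by move=> y _; rewrite (negbTE c12) mulr0.
    rewrite mulr_sumr; apply: eq_bigr => y _.
    by rewrite eqxx mulr1 minxx minE; ring.
  rewrite [X in X + _]big1 ?add0r; last by move=> y _; rewrite eq_sym (negbTE c12) mulr0.
  rewrite mulr_sumr; apply: eq_bigr => y _.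
  by rewrite eqxx mulr1 minxx minE; ring.
have v0 : 0 <= v.
  rewrite vE mulr_ge0 ?divr_ge0 ?(ltW D0)//; apply: sumr_ge0 => z _.
  by rewrite addr_ge0 ?sqr_ge0.
move=> /(centered_normal_charfun mX v0); rewrite vE => <-.
apply: eq_Rintegral => w _; congr cos.
by rewrite big_sumType/= /lincomb !big_mkord.
Qed.

(** Only an upper bound [V] of the variance enters, so one estimate serves the whole grid. Variance
    0 does occur, on the axes. *)
Lemma centered_normal_tail (X : T -> R) (v V l : R) : measurable_fun setT X ->
  0 <= v -> v <= V -> 0 < V -> 0 < l -> centered_normal P X v ->
  (P [set w | (l <= `|X w|)%R] <= (2 * expR (- (l ^+ 2 / (4 * V))))%R%:E)%E.
Proof.
move=> mX v0 vV V0 l0; rewrite /centered_normal.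
have mA : measurable [set u : R | (l <= `|u|)%R].
  by apply: measurable_norm_superlevel.
have [_ X0|vn0 /(_ _ mA) XN] := eqVneq v 0; last first.
  rewrite (_ : [set w | _] = X @^-1` [set u : R | (l <= `|u|)%R])// XN.
  have vp : 0 < v by rewrite lt0r vn0.
  apply: (le_trans (normal_prob_tail _ (ltW l0))); first by rewrite sqrtr_gt0.
  rewrite lee_fin ler_pM2l// ler_expR lerN2 sqr_sqrtr//.
  by rewrite ler_wpM2l ?sqr_ge0// lef_pV2 ?posrE ?mulr_gt0// ler_pM2l.
have mX0 : measurable [set w | X w = 0].
  rewrite (_ : [set w | _] = setT `&` X @^-1` [set 0]); last by rewrite setTI.
  by apply: (mX measurableT) => //; exact: measurable_set1.
apply: (@le_trans _ _ (P (~` [set w | X w = 0]))).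
  apply: le_measure; rewrite ?inE.
  - rewrite -[X in measurable X]setTI; exact: (mX measurableT _ mA).
  - exact: measurableC.
  - by move=> w /= lX X0w; move: lX; rewrite X0w normr0 leNgt l0.
have -> : P (~` [set w | X w = 0]) = 0%E.
  by apply: (etrans (probability_setC P mX0)); rewrite X0 subee.
by rewrite lee_fin mulr_ge0 ?expR_ge0.
Qed.

Lemma sheet_diff_normal c (s t s' t' : R) :
  0 <= s -> 0 <= t -> 0 <= s' -> 0 <= t' ->
  centered_normal P (fun w => B c s' t' w - B c s t w)
   (s' * t' + s * t - 2 * (Num.min s s' * Num.min t t')).
Proof.
move=> s0 t0 s0' t0'.
have := @sheet_linear_comb bool (fun=> c) (fun k => if k then s' else s)
  (fun k => if k then t' else t) (fun k => if k then 1 else -1).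
rewrite big_bool/= !big_bool/= !minxx !eqxx.
under eq_fun do rewrite big_bool/= mul1r mulN1r.
rewrite (minC s' s) (minC t' t).
set v := (X in (_ -> centered_normal _ _ X) -> _).
set v' := (X in _ -> centered_normal _ _ X).
have -> : v = v' by rewrite /v /v' (_ : true%:R = 1 :> R)//; ring.
by apply; case.
Qed.

(** For ordered points the variance of the difference is the area of the larger rectangle outside
    the smaller one. *)
Lemma sheet_increment_tail c (s t s' t' V l : R) :
  0 <= s <= s' -> 0 <= t <= t' ->
  s' * t' - s * t <= V -> 0 < V -> 0 < l ->
  (P [set w | (l <= `|B c s' t' w - B c s t w|)%R] <=
    (2 * expR (- (l ^+ 2 / (4 * V))))%R%:E)%E.
Proof.
move=> /andP[s0 ss] /andP[t0 tt] sV V0 l0.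
have s0' := le_trans s0 ss; have t0' := le_trans t0 tt.
have vE : s' * t' + s * t - 2 * (Num.min s s' * Num.min t t') = s' * t' - s * t.
  by rewrite (min_l ss) (min_l tt); ring.
have := sheet_diff_normal c s0 t0 s0' t0'; rewrite vE.
apply: centered_normal_tail => //.
- by apply: measurable_funB; apply: sheet_measurable.
- by rewrite subr_ge0 ler_pM.
Qed.

End Sheet.

(** Each dyadic block, from [2 ^ p] to [2 ^ p.+1], contributes at most 1. *)
Lemma harmonic_pow2_le (R : realFieldType) p : \sum_(1 <= x < 2 ^ p) x%:R^-1 <= p%:R :> R.
Proof.
elim: p => [|p IH]; first by rewrite expn0 big_geq.
rewrite (big_cat_nat (n := 2 ^ p))/= ?expn_gt0 ?leq_exp2l// -natr1 lerD//.
apply: (@le_trans _ _ (\sum_(2 ^ p <= x < 2 ^ p.+1) (2 ^ p)%:R^-1)).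
  rewrite big_nat [leRHS]big_nat; apply: ler_sum => x /andP[px _].
  by rewrite lef_pV2 ?posrE ?ltr0n ?(leq_trans _ px) ?expn_gt0// ler_nat.
rewrite sumr_const_nat expnS mul2n -addnn addnK -[X in X <= _]mulr_natl divff//.
Qed.

Lemma prob_bigsetU_le (R : realType) (dT : measure_display) (T : measurableType dT)
    (P : probability T R) (I : Type) (r : seq I) (A : I -> set T) (e : R) :
  (forall i, measurable (A i)) -> (forall i, (P (A i) <= e%:E)%E) ->
  (P (\big[setU/set0]_(i <- r) A i) <= ((size r)%:R * e)%:E)%E.
Proof.
move=> mA Ae; elim: r => [|i r IH]; first by rewrite big_nil measure0 mul0r.
rewrite big_cons /= -natr1 mulrDl mul1r addrC EFinD.
apply: le_trans (leeD (Ae i) IH); apply: measureU2 => //.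
exact: bigsetU_measurable.
Qed.

(** One term of the exponential series; polynomial decay is enough against the number of grid
    points. *)
Lemma expRN_le_fact (R : realType) (n : nat) (y : R) : 0 < y ->
  expR (- y) <= n.+1`!%:R / y ^+ n.+1.
Proof.
move=> y0; have f0 : 0 < n.+1`!%:R :> R by rewrite ltr0n fact_gt0.
rewrite expRN -[leRHS]invrK lef_pV2 ?posrE ?expR_gt0 ?invr_gt0 ?divr_gt0 ?exprn_gt0//.
rewrite invf_div; apply: le_trans (expR_ge1Dxn n (ltW y0)).
by rewrite lerDr.
Qed.

(** * Bad events of each level and their summable probabilities *)

Section BadEvents.
Context {R : realType} (dT : measure_display) (T : measurableType dT).
Variables (P : probability T R) (d : nat) (B : 'I_d -> R -> R -> T -> R).
Hypothesis hB : brownian_sheet P B.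
Variables (c1 c2 : 'I_d) (q : nat).
Hypothesis c12 : c1 != c2.
Hypothesis q2 : (2 <= q)%N.

(* Base [b], so that level [m] cells have side [b ^- m] and typical oscillation
   [2 ^- (q * m)]; the factor [2 ^ m] by which [mod_scale ^+ m] exceeds it makes
   the Gaussian tail at level [m] summable over the grid. *)
Definition base := (4 ^ q)%N.
Definition mod_scale : R := (2%:R ^+ q.-1)^-1.
Definition grid_size m := (q * base ^ m)%N.
(** One more than the exponent in [base ^ m = (2 ^ m) ^ (2 q)]: the extra point leaves a factor
    [2 ^ - m] after the union over strips. *)
Definition chain_length := (2 * q).+1.

Let G c m i j w := B c (i%:R / base%:R ^+ m) (j%:R / base%:R ^+ m) w.

Definition big_increment c m i j : set T :=
  [set w | mod_scale ^+ m <= `|G c m i.+1 j w - G c m i j w|] `|`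
  [set w | mod_scale ^+ m <= `|G c m i j.+1 w - G c m i j w|].

Definition increment_bad m : set T :=
  \big[setU/set0]_(i <- iota 0 (grid_size m).+1)
  \big[setU/set0]_(j <- iota 0 (grid_size m).+1)
    (big_increment c1 m i j `|` big_increment c2 m i j).

(** The bound of [gridval_close] for [tau = mod_scale]. *)
Definition hit_radius m : R := 2 * base%:R * mod_scale ^+ m.

(** Least chain sum of a strip with [chain_length + 16 ^ m] hits: a hit weighs at least [expR (-1)],
    half of the exponent from each coordinate. *)
Definition chain_threshold m : R :=
  expR (-1) ^+ chain_length * 'C(chain_length + 16 ^ m, chain_length)%:R.

Definition strip_chains m i w : R :=
  chains (fun j => G c1 m i j) (fun j => G c2 m i j) (hit_radius m)^-1
    (grid_size m) chain_length 0 w.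

(** The condition says that the row [i / base ^ m] is at least [1 / q], which keeps the variance of
    its increments from degenerating. *)
Definition crowded m i : set T :=
  if (base ^ m <= q * i)%N then [set w | chain_threshold m <= strip_chains m i w]
  else set0.

Definition crowded_bad m : set T :=
  \big[setU/set0]_(i <- iota 0 (grid_size m)) crowded m i.

Let F m : R := 2%:R ^+ m.
Let F0 m : 0 < F m. Proof. by rewrite exprn_gt0. Qed.
Let F1 m : 1 <= F m. Proof. by rewrite exprn_ege1// ler1n. Qed.
Let q0 : 0 < q%:R :> R. Proof. by rewrite ltr0n (leq_trans _ q2). Qed.
Let b0 : 0 < base%:R :> R. Proof. by rewrite ltr0n expn_gt0. Qed.
Let D0 m : 0 < base%:R ^+ m :> R. Proof. by rewrite exprn_gt0. Qed.

Lemma mod_scale_gt0 : 0 < mod_scale. Proof. by rewrite invr_gt0 exprn_gt0. Qed.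

Lemma base_pow m : base%:R ^+ m = F m ^+ (2 * q).
Proof.
rewrite /base natrX -!exprM (_ : 4 = 2 ^+ 2 :> R); last by rewrite -natrX.
by rewrite -exprM; congr (_ ^+ _); rewrite mulnA mulnC.
Qed.

Lemma mod_scale_sqr m : (mod_scale ^+ m) ^+ 2 * base%:R ^+ m = F m ^+ 2.
Proof.
rewrite exprAC -exprMn (_ : mod_scale ^+ 2 * base%:R = 4).
  by rewrite exprAC (_ : 4 = 2 ^+ 2 :> R)// -natrX.
rewrite /mod_scale /base natrX exprVn exprAC (_ : 2%:R ^+ 2 = 4 :> R); last by rewrite -natrX.
have -> : q = q.-1.+1 by rewrite prednK// (leq_trans _ q2).
by rewrite /= exprSr mulKf// expf_neq0.
Qed.

Lemma grid_sizeE m : (grid_size m)%:R = q%:R * base%:R ^+ m :> R.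
Proof. by rewrite natrM natrX. Qed.

Lemma measurable_G c m i j : measurable_fun setT (G c m i j).
Proof. by apply: (sheet_measurable hB); rewrite divr_ge0// ltW. Qed.

Lemma measurable_big_increment c m i j : measurable (big_increment c m i j).
Proof.
by apply: measurableU; apply: measurable_norm_superlevel; apply: measurable_funB; exact: measurable_G.
Qed.

Lemma measurable_increment_bad m : measurable (increment_bad m).
Proof.
apply: bigsetU_measurable => i _; apply: bigsetU_measurable => j _.
by apply: measurableU; exact: measurable_big_increment.
Qed.

(** At threshold [mod_scale ^+ m] and variance [q / base ^ m] the Gaussian exponent is
    [F ^ 2 / (4 q)]; its power of order [2 q + 1] gives decay [F ^ - (4 q + 2)]. *)
Let tail_bound m : R :=
  2 * (chain_length`!%:R * (4 * q%:R) ^+ chain_length / F m ^+ (2 * chain_length)).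

Lemma prob_big_increment c m i j : (i <= grid_size m)%N -> (j <= grid_size m)%N ->
  (P (big_increment c m i j) <= (2 * tail_bound m)%:E)%E.
Proof.
move=> iN jN.
have E0 : 0 < F m ^+ 2 by rewrite exprn_gt0.
have tb : 2 * expR (- ((mod_scale ^+ m) ^+ 2 / (4 * (q%:R / base%:R ^+ m)))) <= tail_bound m.
  rewrite ler_pM2l//.
  rewrite (_ : _ ^+ 2 / _ = F m ^+ 2 / (4 * q%:R)); last first.
    by rewrite -mod_scale_sqr; field; rewrite !gt_eqF.
  apply: (le_trans (expRN_le_fact (2 * q) _)); first by rewrite divr_gt0// mulr_gt0.
  by rewrite expr_div_n invf_div mulrA exprM.
have pos (x : nat) : 0 <= x%:R / base%:R ^+ m :> R by rewrite divr_ge0// ltW.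
have leS (x : nat) : x%:R / base%:R ^+ m <= x.+1%:R / base%:R ^+ m :> R.
  by rewrite ler_pM2r ?invr_gt0// ler_nat.
have V0 : 0 < q%:R / base%:R ^+ m :> R by rewrite divr_gt0.
(* A step in one direction has variance the mesh times the other coordinate, which is at most
   [q]. *)
have le_var (x : nat) : (x <= grid_size m)%N ->
    x%:R / base%:R ^+ m * (base%:R ^+ m)^-1 <= q%:R / base%:R ^+ m :> R.
  by move=> xN; rewrite ler_pM2r ?invr_gt0// ler_pdivrMr// -grid_sizeE ler_nat.
have l0 : 0 < mod_scale ^+ m by rewrite exprn_gt0// mod_scale_gt0.
apply: (@le_trans _ _ ((tail_bound m)%:E + (tail_bound m)%:E)%E); last first.
  by rewrite -EFinD lee_fin mulr_natl mulr2n.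
apply: le_trans (measureU2 _ _ _) _ => /=.
- by apply: measurable_norm_superlevel; apply: measurable_funB; exact: measurable_G.
- by apply: measurable_norm_superlevel; apply: measurable_funB; exact: measurable_G.
apply: leeD.
- apply: (@le_trans _ _ (2 * expR (- ((mod_scale ^+ m) ^+ 2 / (4 * (q%:R / base%:R ^+ m)))))%:E);
    last by rewrite lee_fin.
  apply: (sheet_increment_tail hB) => //.
  + by rewrite pos leS.
  + by rewrite pos lexx.
  + apply: le_trans (le_var j jN); rewrite -mulrBl -mulrBl -natr1.
    by rewrite [_%:R + 1]addrC addrK mul1r mulrC.
- apply: (@le_trans _ _ (2 * expR (- ((mod_scale ^+ m) ^+ 2 / (4 * (q%:R / base%:R ^+ m)))))%:E);
    last by rewrite lee_fin.
  apply: (sheet_increment_tail hB) => //.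
  + by rewrite pos lexx.
  + by rewrite pos leS.
  + apply: le_trans (le_var i iN); rewrite -mulrBr -mulrBl -natr1.
    by rewrite [_%:R + 1]addrC addrK mul1r.
Qed.

(** About [F ^ (4 q)] grid points against [F ^ - (4 q + 2)] leave [F ^ - 2], relaxed to the rate
    [1 / F] of the crowded strips. *)
Lemma prob_increment_bad : exists2 K : R, 0 <= K & forall m, (P (increment_bad m) <= (K / F m)%:E)%E.
Proof.
pose K : R := (2 * q%:R) ^+ 2 * 4 * 2 * (chain_length`!%:R * (4 * q%:R) ^+ chain_length).
have K0 : 0 <= K by rewrite !mulr_ge0 ?exprn_ge0 ?mulr_ge0// ltW.
exists K => // m.
have tb0 : 0 <= tail_bound m.
  by rewrite mulr_ge0// divr_ge0 ?exprn_ge0 ?mulr_ge0 ?exprn_ge0 ?mulr_ge0 ?(ltW (F0 _)) ?(ltW q0).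
have inner i j : (i <= grid_size m)%N -> (j <= grid_size m)%N ->
    (P (big_increment c1 m i j `|` big_increment c2 m i j) <= (4 * tail_bound m)%:E)%E.
  move=> iN jN; apply: le_trans (measureU2 _ _ _) _;
    try exact: measurable_big_increment.
  apply: (le_trans (leeD (prob_big_increment c1 iN jN) (prob_big_increment c2 iN jN))).
  by rewrite -EFinD lee_fin -mulrDl (_ : 2 + 2 = 4 :> R)// -natrD.
have mI i j : measurable (big_increment c1 m i j `|` big_increment c2 m i j).
  by apply: measurableU; exact: measurable_big_increment.
apply: (@le_trans _ _ (((grid_size m).+1%:R * ((grid_size m).+1%:R * (4 * tail_bound m)))%:E)).
  rewrite /increment_bad big_seq.
  (* The union bound wants an estimate at every index, so events beyond the grid are replaced by
     [set0]. *)
  rewrite (eq_bigr (fun i => if (i <= grid_size m)%N then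
    \big[setU/set0]_(j <- iota 0 (grid_size m).+1)
      (if (j <= grid_size m)%N then big_increment c1 m i j `|` big_increment c2 m i j else set0)
      else set0)); last first.
    move=> i; rewrite mem_iota add0n ltnS => /andP[_ iN]; rewrite iN.
    rewrite big_seq [RHS]big_seq; apply: eq_bigr => j.
    by rewrite mem_iota add0n ltnS => /andP[_ ->].
  rewrite -big_seq -[X in X%:R * _](size_iota 0 (grid_size m).+1).
  apply: prob_bigsetU_le => i; case: ifP => // iN.
  + by apply: bigsetU_measurable => j _; case: ifP.
  + rewrite -[X in X%:R * _](size_iota 0 (grid_size m).+1).
    apply: prob_bigsetU_le => j; case: ifP => // jN; first exact: inner.
    by rewrite measure0 lee_fin mulr_ge0.
  + by rewrite measure0 lee_fin mulr_ge0// mulr_ge0.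
rewrite lee_fin.
have N2 : (grid_size m).+1%:R <= 2 * q%:R * F m ^+ (2 * q).
  rewrite -mulrA -base_pow -grid_sizeE mulr_natl mulr2n -natr1 lerD2l ler1n.
  by rewrite muln_gt0 (leq_trans _ q2)//= expn_gt0 expn_gt0.
apply: (@le_trans _ _ ((2 * q%:R * F m ^+ (2 * q)) * ((2 * q%:R * F m ^+ (2 * q)) * (4 * tail_bound m)))).
  have tb4 : 0 <= 4 * tail_bound m by rewrite mulr_ge0.
  by rewrite ler_pM// ?(ler_wpM2r tb4)//; apply: mulr_ge0.
apply: (@le_trans _ _ (K / F m ^+ 2)).
  rewrite le_eqVlt; apply/orP; left; apply/eqP.
  rewrite /K /tail_bound /chain_length.
  have -> : F m ^+ (2 * (2 * q).+1) = F m ^+ (2 * q) * F m ^+ (2 * q) * F m ^+ 2.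
    by rewrite -!exprD; congr (_ ^+ _); rewrite mulnS addnC mul2n -addnn.
  have X0 : F m ^+ (2 * q) != 0 by rewrite gt_eqF// exprn_gt0.
  have Y0 : F m != 0 by rewrite gt_eqF.
  move: (F m ^+ (2 * q)) X0 => X X0; move: (F m) Y0 => Y Y0.
  move: (_`!%:R) ((4 * q%:R) ^+ _) => f g.
  by field; rewrite X0 Y0.
rewrite ler_wpM2l// lef_pV2 ?posrE ?exprn_gt0// expr2.
by rewrite ler_peMr// ltW.
Qed.

Lemma hit_radius_gt0 m : 0 < hit_radius m.
Proof. by rewrite !mulr_gt0// exprn_gt0// mod_scale_gt0. Qed.

Lemma measurable_crowded m i : measurable (crowded m i).
Proof.
rewrite /crowded; case: ifP => // _.
apply: measurable_superlevel.
by apply: measurable_chains => x; exact: measurable_G.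
Qed.

Lemma measurable_crowded_bad m : measurable (crowded_bad m).
Proof. by apply: bigsetU_measurable => i _; exact: measurable_crowded. Qed.

Let A : R := 12 * base%:R ^+ 2 * q%:R ^+ 2.

(** The common factor is [r ^ 2 * base ^ m] times [base ^ m / i]: the former equals
    [4 * base ^ 2 * F ^ 2], the latter is at most [q]. The harmonic sum is at most linear in [m],
    hence bounded by a multiple of [F]. *)
Lemma gapsum_crowded_le m (i : nat) : (base ^ m <= q * i)%N ->
  gapsum (i%:R / base%:R ^+ m / base%:R ^+ m) (hit_radius m)^-1 (grid_size m) <= A * F m ^+ 3.
Proof.
move=> iq; have i0 : 0 < i%:R :> R.
  rewrite ltr0n; case: i iq => //; rewrite muln0 leqn0 expn_eq0.
  by rewrite expn_eq0.
have Dqi : base%:R ^+ m <= q%:R * i%:R :> R by rewrite -natrX -natrM ler_nat.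
rewrite /gapsum -mulr_sumr.
have H : \sum_(1 <= x < grid_size m) x%:R^-1 <= 3 * q%:R * F m.
  apply: (@le_trans _ _ (q + 2 * q * m)%:R).
    apply: le_trans (harmonic_pow2_le R _).
    have NE : (grid_size m <= 2 ^ (q + 2 * q * m))%N.
      rewrite expnD /grid_size /base (_ : 4 = 2 ^ 2)%N// -!expnM mulnA leq_mul//.
      exact: ltnW (ltn_expl _ _).
    case: (posnP (grid_size m)) => [->|N0].
      by rewrite big_geq//; apply: sumr_ge0 => x _; rewrite invr_ge0.
    rewrite [leRHS](big_cat_nat (n := grid_size m))//= lerDl.
    by apply: sumr_ge0 => x _; rewrite invr_ge0.
  rewrite natrD natrM natrM (_ : 3 * q%:R * F m = q%:R * F m + 2 * q%:R * F m); last by ring.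
  rewrite lerD//; first by rewrite ler_peMr// ltW.
  rewrite ler_pM2l ?mulr_gt0// /F -natrX ler_nat; exact: ltnW (ltn_expl _ _).
have C : ((hit_radius m)^-1 ^+ 2 * (i%:R / base%:R ^+ m / base%:R ^+ m))^-1 <=
    4 * base%:R ^+ 2 * q%:R * F m ^+ 2.
  rewrite (_ : _^-1 = hit_radius m ^+ 2 * base%:R ^+ m * (base%:R ^+ m / i%:R)); last first.
    by field; rewrite !gt_eqF// hit_radius_gt0.
  rewrite /hit_radius exprMn -(mulrA _ _ (base%:R ^+ m)) mod_scale_sqr exprMn.
  rewrite (_ : 2 ^+ 2 = 4 :> R); last by rewrite -natrX.
  rewrite mulrAC ler_wpM2r ?exprn_ge0 ?(ltW (F0 m))//.
  by rewrite ler_wpM2l ?ler_pdivrMr// mulr_ge0 ?exprn_ge0// ltW.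
apply: (@le_trans _ _ ((4 * base%:R ^+ 2 * q%:R * F m ^+ 2) * (3 * q%:R * F m))).
  rewrite ler_pM//.
    by rewrite invr_ge0 mulr_ge0 ?exprn_ge0 ?invr_ge0 ?divr_ge0 ?(ltW (hit_radius_gt0 _)) ?ltW.
  by apply: sumr_ge0 => x _; rewrite invr_ge0.
by rewrite le_eqVlt; apply/orP; left; apply/eqP; rewrite /A; ring.
Qed.

Lemma chain_threshold_ge m :
  expR (-1) ^+ chain_length * F m ^+ (4 * chain_length) / chain_length`!%:R <= chain_threshold m.
Proof.
rewrite /chain_threshold -mulrA ler_wpM2l ?exprn_ge0 ?expR_ge0//.
rewrite ler_pdivrMr ?ltr0n ?fact_gt0// -natrM.
rewrite exprM (_ : F m ^+ 4 = (16 ^ m)%:R); last first.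
  by rewrite /F exprAC natrX (_ : 2%:R ^+ 4 = 16%:R :> R)// -natrX.
by rewrite -natrX ler_nat expn_le_binM.
Qed.

Lemma chain_threshold_gt0 m : 0 < chain_threshold m.
Proof.
apply: lt_le_trans (chain_threshold_ge m).
by rewrite divr_gt0 ?ltr0n ?fact_gt0// mulr_gt0 ?exprn_gt0 ?expR_gt0.
Qed.

Lemma grid_size_gt0 m : (0 < grid_size m)%N.
Proof. by rewrite muln_gt0 (leq_trans _ q2)//= expn_gt0 expn_gt0. Qed.

Lemma prob_crowded_bad : exists2 K : R, 0 <= K & forall m, (P (crowded_bad m) <= (K / F m)%:E)%E.
Proof.
set n := chain_length; pose L : R := A ^+ n * n`!%:R / expR (-1) ^+ n.
have A0 : 0 <= A by rewrite !mulr_ge0 ?exprn_ge0// ltW.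
have L0 : 0 <= L by rewrite divr_ge0 ?exprn_ge0 ?expR_ge0// mulr_ge0 ?exprn_ge0.
exists (q%:R * L) => [|m]; first by rewrite mulr_ge0// ltW.
have Fn0 k : 0 < F m ^+ k by rewrite exprn_gt0.
apply: (@le_trans _ _ ((grid_size m)%:R * (L / F m ^+ n))%:E); last first.
  rewrite lee_fin grid_sizeE base_pow /n /chain_length exprS le_eqVlt.
  apply/orP; left; apply/eqP.
  have X0 : F m ^+ (2 * q) != 0 by rewrite gt_eqF.
  have Y0 : F m != 0 by rewrite gt_eqF.
  by move: (F m ^+ (2 * q)) X0 => X X0; move: (F m) Y0 => Y Y0; field; rewrite X0 Y0.
rewrite /crowded_bad -[X in X%:R * _](size_iota 0 (grid_size m)).
apply: prob_bigsetU_le => i; first exact: measurable_crowded.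
rewrite /crowded; case: ifP => [iq|_]; last first.
  by rewrite measure0 lee_fin divr_ge0// ltW.
have i0 : 0 < i%:R :> R.
  rewrite ltr0n; case: i iq => //; rewrite muln0 leqn0 expn_eq0.
  by rewrite expn_eq0.
(* The row is [S = i / base ^ m] and the mesh [1 / base ^ m]; this is [k = S / D]. *)
have k0 : 0 < i%:R / base%:R ^+ m / base%:R ^+ m :> R by rewrite !divr_gt0.
have r0 : 0 < (hit_radius m)^-1 by rewrite invr_gt0 hit_radius_gt0.
have S0 : 0 <= i%:R / base%:R ^+ m :> R by rewrite divr_ge0// ltW.
apply: (le_trans (prob_chains_le k0 r0 (fun x => measurable_G c1 m i x)
  (fun x => measurable_G c2 m i x)
  (fun u1 u2 => sheet_grid_charfun hB _ u1 u2 c12 S0 (D0 m)) _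
  (chain_threshold_gt0 m) (grid_size_gt0 m))).
rewrite lee_fin ler_pdivrMr ?chain_threshold_gt0// -/n.
apply: (@le_trans _ _ ((A * F m ^+ 3) ^+ n)).
  by rewrite lerXn2r ?nnegrE ?gapsum_ge0 ?gapsum_crowded_le// mulr_ge0// ltW.
apply: le_trans (ler_wpM2l _ (chain_threshold_ge m)); last by rewrite divr_ge0// ltW.
rewrite -/n le_eqVlt; apply/orP; left; apply/eqP; rewrite /L.
rewrite exprMn -(exprM _ 3 n).
have -> : F m ^+ (4 * n) = F m ^+ (3 * n) * F m ^+ n by rewrite -exprD -mulSnr.
have e0 : expR (-1) ^+ n != 0 :> R by rewrite expf_neq0// gt_eqF ?expR_gt0.
have f0 : n`!%:R != 0 :> R by rewrite pnatr_eq0 -lt0n fact_gt0.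
have X0 : F m ^+ n != 0 by rewrite gt_eqF.
move: (expR _ ^+ n) e0 => e e0; move: (n`!%:R) f0 => f f0.
move: (F m ^+ n) X0 => X X0; move: (A ^+ n) (F m ^+ (3 * n)) => A' Y.
by field; rewrite e0 f0 X0.
Qed.

Definition bad m := increment_bad m `|` crowded_bad m.

Lemma measurable_bad m : measurable (bad m).
Proof.
by apply: measurableU; [exact: measurable_increment_bad|exact: measurable_crowded_bad].
Qed.

Lemma prob_limsup_bad : P (lim_sup_set bad) = 0%E.
Proof.
apply: lim_sup_set_cvg0; first exact: measurable_bad.
have [K1 K10 h1] := prob_increment_bad; have [K2 K20 h2] := prob_crowded_bad.
have K0 : 0 <= 2 * (K1 + K2) by rewrite mulr_ge0// addr_ge0.
(* Borel-Cantelli: [K / 2 ^ m] is rewritten as [2 K / 2 ^ (m + 1)] to sum the geometric series. *)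
apply: (@le_lt_trans _ _ (\sum_(m <oo) (2 * (K1 + K2) / (2 ^ m.+1)%:R)%:E)%E); last first.
  exact: le_lt_trans (epsilon_trick0 xpredT K0) (ltry _).
apply: lee_nneseries => [m *|m *]; first exact: measure_ge0.
apply: le_trans (measureU2 _ _ _) _; [exact: measurable_increment_bad|exact: measurable_crowded_bad|].
apply: (le_trans (leeD (h1 m) (h2 m))); rewrite -EFinD lee_fin -mulrDl.
rewrite natrX exprS invfM mulrA mulrAC -(mulrA _ _ 2^-1) -/(F m).
by rewrite le_eqVlt; apply/orP; left; apply/eqP; field; rewrite gt_eqF.
Qed.

End BadEvents.

(** * Covering a slice outside the bad events *)

Section Slices.
Context {R : realType} (dT : measure_display) (T : measurableType dT).
Variables (P : probability T R) (d : nat) (B : 'I_d -> R -> R -> T -> R).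
Hypothesis hB : brownian_sheet P B.
Variables (c1 c2 : 'I_d).

(** The demands on [q]: [s < q] and [M <= q] keep the slice inside the grid, [2 <= q * s] puts its
    strip above the cutoff despite rounding, and [3 <= q * al] makes [16 ^ m * base ^ (- m al)] at
    most [4 ^ - m]. *)
Lemma slice_small_cover (q : nat) (s al de M : R) w :
  (2 <= q)%N -> 0 < s -> s < q%:R -> 2 <= q%:R * s -> 3 <= q%:R * al ->
  M <= q%:R -> 0 < al -> 0 < de -> ~ lim_sup_set (bad B c1 c2 q) w ->
  small_cover al de [set p | p.1 = s /\
    ([set t | 0 < t < M /\ B c1 s t w = 0 /\ B c2 s t w = 0] p.2)].
Proof.
move=> q2 s0 sq qs qal Mq al0 de0 nbad e e0.
have [m0 hm0] : exists m0, forall m, (m0 <= m)%N -> ~ bad B c1 c2 q m w.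
  apply: contrapT => h; apply: nbad => n _; apply: contrapT => nb.
  apply: h; exists n => m nm bm; apply: nb; by exists m.
have b1 : (1 < base q)%N by rewrite (@ltn_exp2l 4 0)// (leq_trans _ q2).
have b0 : 0 < (base q)%:R :> R by rewrite ltr0n ltnW.
have tau0 := @mod_scale_gt0 R q.
have tau2 : 2 * mod_scale q <= 1 :> R.
  rewrite /mod_scale ler_pdivrMr ?exprn_gt0// mul1r -[leLHS]expr1 ler_eXn2l ?ltr1n//.
  by rewrite -ltnS prednK// (leq_trans _ q2).
pose N m := grid_size q m.
have inc c m : c = c1 \/ c = c2 -> (m0 <= m)%N ->
    small_increments (fun s t => B c s t w) (base q) q (mod_scale q) m.
  move=> cc mm i j iN jN; have nb := hm0 m mm.
  have in_iota k : (k <= grid_size q m)%N -> k \in iota 0 (grid_size q m).+1.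
    by rewrite mem_iota add0n ltnS.
  have nbi : ~ big_increment B q c m i j w.
    move=> bi; apply: nb; left; rewrite /increment_bad -bigcup_seq.
    exists i; first exact: in_iota.
    rewrite -bigcup_seq; exists j; first exact: in_iota.
    by case: cc => <-; [left|right].
  split; rewrite leNgt; apply/negP => /ltW h; apply: nbi; [by left|by right].
have cont c : {within [set p : R * R | 0 <= p.1 /\ 0 <= p.2],
    continuous (fun p => B c p.1 p.2 w)}.
  by case: hB => _ [+ _]; apply.
pose n := chain_length q; pose x1 := (n.+1)%:R / e.
(* A level past [m0], with mesh at most [de] and [(n + 1) * 4 ^ - m] at most [e]; a sum of integer
   parts is large enough because [m < 4 ^ m]. *)
pose m := (m0 + (Num.truncn de^-1).+1 + (Num.truncn x1).+1)%N.
have m0m : (m0 <= m)%N by rewrite /m -addnA leq_addr.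
have m1 : (0 < m)%N by rewrite /m addnS.
have D0 : 0 < (base q)%:R ^+ m :> R by rewrite exprn_gt0.
have m4D : (4 ^ m <= base q ^ m)%N.
  by rewrite leq_exp2r// /base -[X in (X <= _)%N]expn1 leq_exp2l// (leq_trans _ q2).
have mD : (m < base q ^ m)%N by apply: (leq_trans (ltn_expl m (isT : 1 < 4)%N)).
have hde : ((base q)%:R ^+ m)^-1 <= de.
  rewrite -[leRHS]invrK lef_pV2 ?posrE ?invr_gt0//.
  apply: (le_trans (ltW (truncnS_gt _))); rewrite -natrX ler_nat.
  apply: leq_trans (ltnW mD); rewrite /m -addnA addnCA leq_addr//.
pose Z : set R := [set t | 0 < t < M /\ B c1 s t w = 0 /\ B c2 s t w = 0].
pose i := Num.truncn (s * (base q)%:R ^+ m).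
have sD0 : 0 <= s * (base q)%:R ^+ m by rewrite mulr_ge0 ?ltW.
have /andP[i1 i2] := truncn_itv sD0.
have cellN (t : R) : 0 <= t -> t < q%:R -> (Num.truncn (t * (base q)%:R ^+ m) < N m)%N.
  move=> t0 tq; have /andP[le _] := truncn_itv (mulr_ge0 t0 (ltW D0)).
  rewrite -(ltr_nat R) (le_lt_trans le)// /N grid_sizeE ltr_pM2r//.
have iN : (i < N m)%N by apply: cellN; [exact: ltW|].
have qD : (q <= base q ^ m)%N.
  apply: (leq_trans (ltnW (ltn_expl q (isT : 1 < 4)%N))).
  by rewrite /base -[X in (X <= _)%N]expn1 leq_exp2l// b1.
(* With [D = base ^ m]: [2 D <= q s D <= q (i + 1)] and [q <= D]. The factor 2 pays for rounding [s]
   down. *)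
have Dqi : (base q ^ m <= q * i)%N.
  rewrite -(ler_nat R) natrM natrX.
  have h1 : q%:R * (s * (base q)%:R ^+ m) <= q%:R * i.+1%:R.
    by rewrite ler_pM2l ?ltr0n ?(leq_trans _ q2)// ltW.
  have h2 : 2 * (base q)%:R ^+ m <= q%:R * (s * (base q)%:R ^+ m) by rewrite mulrA ler_pM2r.
  have h3 : q%:R <= (base q)%:R ^+ m :> R by rewrite -natrX ler_nat.
  move: h1 h2 h3; rewrite -natr1 mulrDr mulr1.
  by move=> h1 h2 h3; lra.
have ncrowd : strip_chains B c1 c2 q m i w < chain_threshold q m.
  rewrite ltNge; apply/negP => h; apply: (hm0 m m0m); right.
  rewrite /crowded_bad -bigcup_seq; exists i; first by move: iN; rewrite -[(i < _)%N](mem_iota 0).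
  by rewrite /crowded Dqi.
pose Gv c j := B c (i%:R / (base q)%:R ^+ m) (j%:R / (base q)%:R ^+ m) w.
pose hit j := (`|Gv c1 j| <= hit_radius q m) && (`|Gv c2 j| <= hit_radius q m).
have Zhit t : Z t -> (Num.truncn (t * (base q)%:R ^+ m) < N m)%N /\
    hit (Num.truncn (t * (base q)%:R ^+ m)).
  move=> [/andP[t0 tM] [z1 z2]]; have tq : t < q%:R := lt_le_trans tM Mq.
  split; first by apply: cellN => //; exact: ltW.
  have close c : c = c1 \/ c = c2 -> B c s t w = 0 ->
      `|Gv c (Num.truncn (t * (base q)%:R ^+ m))| <= hit_radius q m.
    move=> cc z; rewrite -normrN -[- _]add0r -z.
    exact: (gridval_close b1 (ltW tau0) tau2 (cont c) (fun m' => inc c m' cc)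
      (ltW s0) (ltW t0) sq tq m0m).
  by apply/andP; split; apply: close => //; [left|right].
(* More hits would push the chain sum over the threshold. Chains start strictly after 0, hence the
   sum from 1. *)
have few : (\sum_(1 <= j < N m) hit j < n + 16 ^ m)%N.
  rewrite ltnNge; apply/negP => many.
  have : chain_threshold q m <= strip_chains B c1 c2 q m i w.
    have e10 := expR_ge0 (-1 : R).
    apply: le_trans (chains_ge_binomial (N m) (hit := hit) n 0 e10 _).
      by rewrite /chain_threshold ler_wpM2l ?exprn_ge0// ler_nat leq_bin2l.
    move=> j /andP[h1 h2].
    have r0 := @hit_radius_gt0 R q m.
    have kern (x : R) : `|x| <= hit_radius q m ->
        expR (- (1 / 2)) <= expR (- (x ^+ 2 * (hit_radius q m)^-1 ^+ 2 / 2)).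
      move=> xr; rewrite ler_expR lerN2 ler_pM2r// exprVn ler_pdivrMr ?exprn_gt0// mul1r.
      by rewrite -(real_normK (num_real x)) lerXn2r ?nnegrE// ltW.
    rewrite (_ : -1 = - (1 / 2) + - (1 / 2)); last by field.
    by rewrite expRD /hitw ler_pM ?expR_ge0//; exact: kern.
  by rewrite leNgt ncrowd.
have N0 := grid_size_gt0 q2 m.
apply: (@small_cover_slice _ s Z al de ((base q)%:R ^+ m)^-1 ((n.+1)%:R * 16%:R ^+ m)) => //.
- by rewrite invr_gt0.
- by move=> t [/andP[/ltW]].
- move=> k.
  pose a j := `[< exists2 t, Z t & Num.truncn (t / ((base q)%:R ^+ m)^-1) = j >].
  have aE j : a j -> (j < N m)%N /\ hit j.
    by move=> /asboolP[t Zt <-]; rewrite invrK; exact: Zhit.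
  rewrite -natr_sum -(natrX _ 16) -natrM ler_nat -/a.
  apply: (@leq_trans (\sum_(0 <= j < N m + k) a j)%N).
    by rewrite [leqRHS](big_cat_nat (n := k))//= ?leq_addl// leq_addr.
  rewrite (big_cat_nat (n := N m))//= ?leq_addr// [X in (_ + X)%N]big_nat [X in (_ + X)%N]big1 ?addn0; last first.
    move=> j /andP[Nj _]; case: (boolP (a j)) => // /aE[jN _].
    by rewrite leqNgt jN in Nj.
  (* The added 1 allows for the time cell at 0, which no chain visits. *)
  apply: (@leq_trans (1 + \sum_(1 <= j < N m) hit j)%N).
    rewrite big_ltn// leq_add ?leq_b1//; apply: leq_sum => j _.
    by case: (boolP (a j)) => // /aE[_ ->].
  apply: (@leq_trans (n + 16 ^ m)%N); first by rewrite add1n.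
  by rewrite mulSn addnC leq_add2l leq_pmulr// expn_gt0.
(* The mesh is [g ^ q], so its power [al] is at most [g ^ 3]; the factor [16 ^ m] cancels two of the
   three factors [g]. *)
- pose g : R := (4%:R ^+ m)^-1.
  have g0 : 0 < g by rewrite invr_gt0 exprn_gt0.
  have g1 : g <= 1 by rewrite invf_le1 ?exprn_gt0// exprn_ege1// ler1n.
  have hg : ((base q)%:R ^+ m)^-1 `^ al <= g ^+ 3.
    have -> : ((base q)%:R ^+ m)^-1 = g `^ q%:R.
      by rewrite powR_mulrn ?(ltW g0)// /g /base natrX exprVn exprAC.
    rewrite -powRrM -powR_mulrn ?(ltW g0)//.
    by apply: ger_powR => //; rewrite g0 g1.
  apply: (@le_trans _ _ ((n.+1)%:R * 16%:R ^+ m * g ^+ 3)).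
    by rewrite ler_wpM2l// mulr_ge0// exprn_ge0.
  have g3 : 16%:R ^+ m * g ^+ 3 = g :> R.
    rewrite (_ : 16%:R = 4%:R ^+ 2 :> R); last by rewrite -natrX.
    rewrite exprAC /g exprVn; field; exact: lt0r_neq0 (exprn_gt0 _ _).
  have e4 : n.+1%:R / e < 4%:R ^+ m.
    apply: (lt_le_trans (truncnS_gt _)); rewrite -natrX ler_nat.
    apply: leq_trans (ltnW (ltn_expl m (isT : 1 < 4)%N)).
    by rewrite /m -/x1 leq_addl.
  rewrite -(mulrA _ (16%:R ^+ m)) g3 /g ler_pdivrMr ?exprn_gt0//.
  by move: e4; rewrite ltr_pdivrMr// mulrC => /ltW.
Qed.

End Slices.

(** * A single null set for all slices *)

Unset Implicit Arguments.
Set Strict Implicit.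

Theorem theorem1p2 (R : realType) (dT : measure_display) (T : measurableType dT)
    (P : probability T R) (d : nat) (B : 'I_d -> R -> R -> T -> R) :
  (d = 2%N \/ d = 3%N) ->
  brownian_sheet P B ->
  exists N : set T, measurable N /\ P N = 0%E /\
    forall w, ~ N w ->
      forall s : R, 0 < s ->
        hausdorff_dim [set p : R * R | p.1 = s /\ 0 < p.2 /\
                                       forall i, B i p.1 p.2 w = 0] = 0%E.
Proof.
move=> d23 hB.
have [c1 [c2 c12]] : exists c1 c2 : 'I_d, c1 != c2.
  have d1 : (1 < d)%N by case: d23 => ->.
  by exists (Ordinal (ltnW d1)), (Ordinal d1).
(* The shift enforces [2 <= q]. Countably many values serve every [s], [al] and [de]. *)
pose bad' q := lim_sup_set (bad B c1 c2 q.+2).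
have mbad q : measurable (bad' q).
  apply: bigcap_measurable => // n _; apply: bigcup_measurable => m _.
  exact: (measurable_bad hB).
exists (\bigcup_q bad' q); split; first exact: bigcup_measurable.
split.
  apply: (measure_negligible (bigcup_measurable (fun q _ => mbad q))).
  apply: negligible_bigcup => q; exists (bad' q); split => //.
  exact: (prob_limsup_bad hB c12).
move=> w nw s s0; apply: hausdorff_dim0 => al de al0 de0.
(* The half-line of times is exhausted by bounded ranges, since each grid covers only times below
   [q]. *)
pose E (M : nat) := [set p : R * R | p.1 = s /\
  [set t | 0 < t < M%:R /\ B c1 s t w = 0 /\ B c2 s t w = 0] p.2].
have cE : small_cover al de (\bigcup_M E M).
  apply: small_cover_bigcup => M.
  pose q0 := (M + (Num.truncn s).+1 + (Num.truncn (2 / s)).+1 + (Num.truncn (3 / al)).+1)%N.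
  have le_q0 (x : R) (k : nat) : (Num.truncn x < k)%N -> (k <= q0)%N -> x < q0.+2%:R.
    move=> xk kq; apply: (lt_le_trans (truncnS_gt x)); rewrite ler_nat.
    by rewrite (leq_trans xk)// (leq_trans kq)// leqW.
  apply: (slice_small_cover hB (q := q0.+2)) => //.
  - apply: (le_q0 _ (Num.truncn s).+1) => //; rewrite /q0; lia.
  - rewrite -ler_pdivrMr//; apply/ltW.
    apply: (le_q0 _ (Num.truncn (2 / s)).+1) => //; rewrite /q0; lia.
  - rewrite -ler_pdivrMr//; apply/ltW.
    apply: (le_q0 _ (Num.truncn (3 / al)).+1) => //; rewrite /q0; lia.
  - rewrite ler_nat /q0; lia.
  - by move=> lw; apply: nw; exists q0.
move=> e e0; have [U [EU Ude Ue]] := cE e e0; exists U; split => //.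
apply: subset_trans EU => p [p1 [p20 pz]].
exists (Num.truncn p.2).+1 => //; split => //=.
by rewrite p20 truncnS_gt -p1 !pz.
Qed.
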